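(* Let $\Omega$ be a compact metric space, $\alpha>0$, and $\nu_0\in\mathcal M_1(\Omega)$ with support $\Omega$. Let $f\in\mathcal C(\Omega)$ and $u\in[f_{\min},f_{\max})$, where $f_{\max}=\max_{x\in\Omega} f(x)$ and $f_{\min}=\min_{x\in\Omega} f(x)$. Then $$\log \mathbb P_{X\sim \mathrm{DP}(\alpha\nu_0)}\big(\mathbb E_X[f]\ge u\big)\le -\max_{\eta\in\mathcal M(\Omega),\ \eta(\Omega)\le 1,\ \eta\le \alpha\nu_0}\ (\alpha-\eta(\Omega))\,\mathcal K_{\inf}\!\left(\frac{\alpha\nu_0-\eta}{\alpha-\eta(\Omega)},u,f\right).$$ In addition, a maximizer $\eta^*\in\mathcal M(\Omega)$ is computed as $$\eta^*=\begin{cases}\alpha\nu_0(\,\cdot\cap A_1) & \text{if }\alpha\nu_0(A_1)=1,\\[4pt] \alpha\nu_0(\,\cdot\cap A_1)+\dfrac{1-\alpha\nu_0(A_1)}{\nu_0(A_0)}\,\nu_0(\,\cdot\cap A_0) & \text{if }\alpha\nu_0(A_1)<1,\end{cases}$$ where $u_1=\inf\{x\ge u:\ \alpha\nu_0(f^{-1}((x,\infty)))\le 1\}$, $A_0=f^{-1}(\{u_1\})$ and $A_1=f^{-1}((u_1,\infty))$.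
   Context: $\mathcal M(\Omega)$ (resp. $\mathcal M_1(\Omega)$) is the set of finite non-negative (resp. probability) Borel measures on $\Omega$ (the zero measure belongs to $\mathcal M(\Omega)$); $\mathcal C(\Omega)$ is the set of continuous functions $\Omega\to\mathbb R$. $\eta\le\alpha\nu_0$ means $\eta(A)\le\alpha\nu_0(A)$ for all Borel $A$. $\mathrm{DP}(\alpha\nu_0)$ is the Dirichlet process law with scale $\alpha$ and base distribution $\nu_0$: the law of a random probability measure $X$ on $\Omega$ such that for every finite measurable partition $B_1\sqcup\dots\sqcup B_k=\Omega$, $(X(B_1),\dots,X(B_k))\sim\mathrm{Dir}(\alpha\nu_0(B_1),\dots,\alpha\nu_0(B_k))$ (coordinates with zero parameter being a.s. $0$). $\mathbb E_X[f]=\int f\,dX$. The Kullback–Leibler divergence is $\mathrm{KL}(\nu\|\mu)=\mathbb E_\nu[\log\frac{d\nu}{d\mu}]$ if $\nu\ll\mu$ and $+\infty$ otherwise. For $\nu\in\mathcal M_1(\Omega)$, $f\in\mathcal C(\Omega)$, $u\in\mathbb R$, $$\mathcal K_{\inf}(\nu,u,f)=\inf\{\mathrm{KL}(\nu\|\mu):\ \mu\in\mathcal M_1(\Omega),\ \mathbb E_\mu[f]\ge u\},$$ with $\inf\emptyset=\infty$. When $\eta(\Omega)=\alpha$ (i.e. $\eta=\alpha\nu_0$), the expression $(\alpha-\eta(\Omega))\,\mathcal K_{\inf}(\cdot)$ is read as $0$.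
   Formalization: The displayed formula for η* is asserted when αν0(A0∪A1) ≥ 1; when αν0(A0∪A1) < 1, where the displayed measure is not ≤ αν0 or its coefficient reads 0/0, the maximizer asserted is instead αν0(·∩(A0∪A1)). *)

(* Defs.v *)
From HB Require Import structures.
From mathcomp Require Import all_boot all_order all_algebra.
From mathcomp Require Import all_classical all_reals all_analysis.

Set Implicit Arguments.
Unset Strict Implicit.
Unset Printing Implicit Defensive.

Import Order.TTheory GRing.Theory Num.Theory.
Import numFieldNormedType.Exports.

Local Open Scope classical_set_scope.
Local Open Scope ring_scope.

(* Measurable types are pointed in MathComp-Analysis.  Nonemptiness is no
   restriction here: an empty space carries no probability measure. *)
#[short(type="pmetricType")]
HB.structure Definition PointedMetric (K : numDomainType) :=
  {T of Pointed T & Metric K T}.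

Definition borel (T : ptopologicalType) : measurableType (@open T).-sigma :=
  g_sigma_algebraType (@open T).

Definition msupport (R : realType) (T : ptopologicalType)
    (mu : {measure set (borel T) -> \bar R}) : set T :=
  [set x | forall U : set T, open U -> U x -> (0 < mu U)%E].

(* Gamma(a, 1) law; shape 0 is the point mass at 0. *)
Definition gamma_fun (R : realType) (a : R) : R :=
  \int[lebesgue_measure]_(x in `]0, +oo[) (x `^ (a - 1) * expR (- x)).

Definition gamma_pdf (R : realType) (a : R) : R -> R :=
  (fun x => x `^ (a - 1) * expR (- x) / gamma_fun a) \_ `]0, +oo[.

Definition gamma_prob (R : realType) (a : R) : set R -> \bar R :=
  if a == 0 then dirac (0 : measurableTypeR R)
  else fun A => (\int[lebesgue_measure]_(x in A) (gamma_pdf a x)%:E)%E.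

(* The law of n independent variables with laws [P_ i], on R^n. *)
Definition is_product_law (R : realType) (n : nat) (P_ : 'I_n -> set R -> \bar R)
    (Q : probability (n.-tuple R) R) : Prop :=
  forall A : 'I_n -> set R, (forall i, measurable (A i)) ->
    Q [set y | forall i, A i (tnth y i)] = (\prod_(i < n) P_ i (A i))%E.

(* Ferguson's definition of Dir(a_1, ..., a_n), for a_i >= 0 not all zero: the
   law of (Z_1, ..., Z_n) / (Z_1 + ... + Z_n) with Z_i ~ Gamma(a_i, 1)
   independent.  A coordinate with a_i = 0 is thus a.s. 0. *)
Definition is_dirichlet (R : realType) (n : nat) (a : 'I_n -> R)
    (D : set (n.-tuple R) -> \bar R) : Prop :=
  exists2 Q : probability (n.-tuple R) R,
    is_product_law (fun i => gamma_prob (a i)) Q &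
    forall C : set (n.-tuple R), measurable C ->
      D C = Q [set y | C [tuple tnth y i / \sum_(j < n) tnth y j | i < n]].

(* DP(alpha nu0), as a law on the space of probability measures. *)
Definition is_dirichlet_process (R : realType) d (T : measurableType d)
    (alpha : R) (nu0 : probability T R)
    (P : probability (pprobability T R) R) : Prop :=
  forall (n : nat) (B : 'I_n -> set T),
    (forall i, measurable (B i)) -> trivIset setT B ->
    \bigcup_i B i = setT ->
    is_dirichlet (fun i => alpha * fine (nu0 (B i)))
      (pushforward P
        (fun X : probability T R => [tuple fine (X (B i)) | i < n])).

Definition KL (R : realType) d (T : measurableType d)
    (nu mu : probability T R) : \bar R :=
  if `[< nu `<< mu >] then
    (\int[nu]_x lne (Radon_Nikodym (charge_of_finite_measure nu) mu x))%E
  else +oo%E.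

Definition Kinf (R : realType) d (T : measurableType d)
    (nu : probability T R) (u : R) (f : T -> R) : \bar R :=
  ereal_inf [set KL nu mu |
    mu in [set mu : probability T R | (u%:E <= 'E_mu[f])%E]].

Definition mle (R : realType) d (T : measurableType d)
    (eta mu : set T -> \bar R) : Prop :=
  forall A, measurable A -> (eta A <= mu A)%E.

(* [mu - eta] when [eta <= mu], and the zero measure otherwise; [maxe 0] only
   matters on non-measurable sets. *)
Definition mdiff (R : realType) d (T : measurableType d)
    (mu eta : {finite_measure set T -> \bar R}) : set T -> \bar R :=
  if `[< mle eta mu >] then fun A => maxe 0%E (mu A - eta A)%E else mzero.

Lemma mdiffE (R : realType) d (T : measurableType d)
    (mu eta : {finite_measure set T -> \bar R}) (A : set T) :
  mle eta mu -> measurable A -> mdiff mu eta A = (mu A - eta A)%E.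
Proof.
move=> etamu mA; rewrite /mdiff asboolT//; apply/max_idPr.
by rewrite sube_ge0 ?etamu// fin_num_measure.
Qed.

Lemma mdiff0 (R : realType) d (T : measurableType d)
    (mu eta : {finite_measure set T -> \bar R}) : mdiff mu eta set0 = 0%E.
Proof.
by rewrite /mdiff; case: ifPn => // _; rewrite !measure0 sube0 maxxx.
Qed.

Lemma mdiff_ge0 (R : realType) d (T : measurableType d)
    (mu eta : {finite_measure set T -> \bar R}) (A : set T) :
  (0 <= mdiff mu eta A)%E.
Proof. by rewrite /mdiff; case: ifPn => // _; rewrite le_max lexx. Qed.

Lemma mdiff_semi_sigma_additive (R : realType) d (T : measurableType d)
    (mu eta : {finite_measure set T -> \bar R}) :
  semi_sigma_additive (mdiff mu eta).
Proof.
have [etamu|netamu] := pselect (mle eta mu); last first.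
  by rewrite /mdiff asboolF//; exact: measure_semi_sigma_additive.
move=> F mF tF mUF; rewrite mdiffE//.
rewrite (_ : (fun n => _) =
  (fun n => \sum_(0 <= i < n) mu (F i) - \sum_(0 <= i < n) eta (F i))%E).
  apply: cvgeB; [|exact: measure_semi_sigma_additive..].
  by rewrite fin_num_adde_defr// fin_num_measure.
apply/funext => n; rewrite -fin_num_sumeN; last first.
  by move=> i _; exact: fin_num_measure.
by rewrite -big_split/=; apply: eq_bigr => i _; rewrite mdiffE.
Qed.

HB.instance Definition _ (R : realType) d (T : measurableType d)
    (mu eta : {finite_measure set T -> \bar R}) :=
  isMeasure.Build d T R (mdiff mu eta) (mdiff0 mu eta)
    (mdiff_ge0 mu eta) (@mdiff_semi_sigma_additive R d T mu eta).

Definition feasible (R : realType) d (T : measurableType d) (alpha : {posnum R})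
    (nu0 : probability T R) (eta : {finite_measure set T -> \bar R}) : Prop :=
  (eta setT <= 1)%E /\ mle eta (mscale alpha%:num%:nng%R nu0).

(* When [eta setT = alpha], the first factor is 0 and hence so is the product,
   since [0 * x = 0] in [\bar R]; the default value of [mnormalize] is then
   irrelevant. *)
Definition objective (R : realType) d (T : measurableType d)
    (alpha : {posnum R}) (nu0 : probability T R) (u : R) (f : T -> R)
    (eta : {finite_measure set T -> \bar R}) : \bar R :=
  ((alpha%:num%:E - eta setT) *
    Kinf (mnormalize (mdiff (mscale alpha%:num%:nng%R nu0) eta) nu0) u f)%E.

Lemma mnormalize_mdiffE (R : realType) d (T : measurableType d)
    (alpha : {posnum R}) (nu0 : probability T R)
    (eta : {finite_measure set T -> \bar R}) (A : set T) :
  feasible alpha nu0 eta -> (eta setT < alpha%:num%:E)%E -> measurable A ->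
  mnormalize (mdiff (mscale alpha%:num%:nng%R nu0) eta) nu0 A =
  ((alpha%:num%:E * nu0 A - eta A)
    * (alpha%:num - fine (eta setT))^-1%:E)%E.
Proof.
move=> [_ etale] etalt mA; rewrite /mnormalize/= (mdiffE etale measurableT) /= /mscale/=.
rewrite probability_setT mule1.
have etaf : eta setT \is a fin_num by exact: fin_num_measure.
move: etalt; rewrite -(fineK etaf) lte_fin => etalt.
rewrite -EFinB eqe subr_eq0 gt_eqF//=.
by rewrite (mdiffE etale mA).
Qed.

Definition u1 (R : realType) d (T : measurableType d) (alpha : {posnum R})
    (nu0 : probability T R) (f : T -> R) (u : R) : R :=
  inf [set x | u <= x /\ (alpha%:num%:E * nu0 (f @^-1` `]x, +oo[) <= 1)%E].

Definition A0 (R : realType) d (T : measurableType d) (alpha : {posnum R})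
    (nu0 : probability T R) (f : T -> R) (u : R) : set T :=
  f @^-1` [set u1 alpha nu0 f u].

Definition A1 (R : realType) d (T : measurableType d) (alpha : {posnum R})
    (nu0 : probability T R) (f : T -> R) (u : R) : set T :=
  f @^-1` `]u1 alpha nu0 f u, +oo[.

(* The second formula satisfies [eta_star <= alpha nu0] only when
   [alpha nu0 (A1 `|` A0) >= 1].  Otherwise u1 = u, and the coefficient exceeds
   alpha, or is 0 by the convention x / 0 = 0. *)
Definition eta_star (R : realType) d (T : measurableType d)
    (alpha : {posnum R}) (nu0 : probability T R) (f : T -> R) (u : R)
    (A : set T) : \bar R :=
  let A0 := A0 alpha nu0 f u in
  let A1 := A1 alpha nu0 f u in
  if (alpha%:num%:E * nu0 A1 == 1)%E then (alpha%:num%:E * nu0 (A `&` A1))%E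
  else (alpha%:num%:E * nu0 (A `&` A1) +
    ((1 - alpha%:num * fine (nu0 A1)) / fine (nu0 A0))%:E * nu0 (A `&` A0))%E.

(* Main.v *)
Require Import Defs.
From HB Require Import structures.
From mathcomp Require Import all_boot all_order all_algebra.
From mathcomp Require Import all_classical all_reals all_analysis.
From mathcomp Require Import measurable_realfun lra ring.
Import Order.TTheory GRing.Theory Num.Theory.
Import numFieldNormedType.Exports.
Local Open Scope classical_set_scope.
Local Open Scope ring_scope.
Set Implicit Arguments.
Unset Strict Implicit.
Unset Printing Implicit Defensive.

(** Write [Y = fmax - u] and [tilt l = 1 - l (f - u)] for [0 <= l < 1 / Y].

    Duality. [Kinf nu u f] is the supremum over [l] of [\int ln (tilt l) d nu].
    That it is at least each of these integrals ([dual_le_Kinf]) is the easy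
    half of the Donsker-Varadhan formula, since [\int tilt l d mu <= 1] as soon
    as the mean of [f] under [mu] is at least [u].  For the converse
    ([Kinf_le_dual]) one exhibits nearly optimal measures: [nu / tilt l] for a
    critical [l], completed if necessary by an atom at a maximum of [f].
    Multiplying by [alpha - eta(T)] undoes the normalization, so the objective
    at [eta] is the supremum over [l] of the integrals of [ln (tilt l)] against
    [alpha nu0 - eta] ([objective_le_dual], [dual_le_objective]).

    Optimality. For fixed [l] the function [ln (tilt l)] decreases with [f] and
    is nonpositive where [f >= u].  To make its integral against
    [alpha nu0 - eta] large, [eta] should therefore take its unit of mass where
    [f] is largest, and stop at the level [u].  This choice does not depend on
    [l], so it is optimal for all [l] at once ([integral_mdiff_cut]) and hence
    maximizes the objective.

    The bound. Cut the space into the set [f > u1], the level [f = u1] and thin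
    slices of [f < u1].  By the gamma representation of the Dirichlet law, the
    probability that the mean of [f] is at least [u] is at most that of
    [\sum_i Z_i y_i >= 0] with independent [Z_i] of law Gamma(a_i, 1), where
    [y_i] bounds [f - u] on the i-th cell and [a_i] is the mass of that cell
    under [alpha nu0]: a half-space through the origin is a cone, so
    dividing by [\sum_i Z_i] changes nothing ([dirichlet_process_le_tail]).
    Chernoff's bound would give [\prod_i (1 - l y_i)^(- a_i)], that is the
    exponential of minus the dual integral for [eta = 0].  The gain is that a
    unit of shape at the top combines, by convolution of gamma laws, into an
    exponential variable [E], for which [P (w + E Y >= 0) <= e^(l w)] without
    the factor [(1 - l Y)^(- 1)] ([tail_exp1], [tail_top]).  (When there is less
    than a unit of mass where [f >= u], shape can be added for free at the weight
    [y = 0] of the level [f = u].)  So the mass taken by the optimal [eta]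
    disappears from the product ([tail_cells]), and letting the width of the
    slices tend to 0 bounds the logarithm of the probability by minus the dual
    integral at this [eta], for every [l] ([dirichlet_process_le_dual]). *)

(** * Measures and integrals *)

(** The measurability proof is an argument because the structure of measure on
    [pushforward] cannot be inferred without it. *)
Definition image_measure d1 d2 (T1 : measurableType d1)
    (T2 : measurableType d2) (R : realType) (m : {measure set T1 -> \bar R})
    (f : T1 -> T2) (mf : measurable_fun setT f) : {measure set T2 -> \bar R} :=
  measure_function_pushforward__canonical__measure_function_Measure m mf.

Lemma ge0_integral_image d1 d2 (T1 : measurableType d1)
    (T2 : measurableType d2) (R : realType) (m : {measure set T1 -> \bar R})
    (f : T1 -> T2) (mf : measurable_fun setT f) (D : set T2)
    (F : T2 -> \bar R) :
  measurable D -> measurable_fun setT F -> (forall x, 0 <= F x)%E ->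
  (\int[image_measure m mf]_(y in D) F y = \int[m]_(x in f @^-1` D) F (f x))%E.
Proof.
move=> mD mF F0; apply: (ge0_integral_pushforward mf) => //.
exact: measurable_funTS.
Qed.

Lemma mnormalizeE d (T : measurableType d) (R : realType)
    (m : {measure set T -> \bar R}) (P : probability T R) (r : R) A :
  0 < r -> m setT = r%:E -> mnormalize m P A = (r^-1%:E * m A)%E.
Proof.
move=> r0 mT.
by rewrite /mnormalize mT eqe gt_eqF//= muleC.
Qed.

Lemma mnormalize1E d (T : measurableType d) (R : realType)
    (m : {measure set T -> \bar R}) (P : probability T R) A :
  (m setT = 1)%E -> mnormalize m P A = m A.
Proof. by move=> mT; rewrite (mnormalizeE _ _ ltr01 mT) invr1 mul1e. Qed.

Lemma integral_cst_probability d (T : measurableType d) (R : realType)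
    (P : probability T R) (r : R) : (\int[P]_x r%:E = r%:E)%E.
Proof.
rewrite -[LHS]/(\int[P]_x cst r%:E x)%E integral_cst// -[RHS]mule1.
by congr (_ * _)%E; exact: probability_setT.
Qed.

Lemma integrable_bounded_lty d (T : measurableType d) (R : realType)
    (mu : {measure set T -> \bar R}) (f : T -> R) (M : R) :
  (mu setT < +oo)%E -> measurable_fun setT f -> (forall x, `|f x| <= M) ->
  mu.-integrable setT (EFin \o f).
Proof.
move=> muoo mf fM; apply: measurable_bounded_integrable => //.
exists M; split; first exact: num_real.
by move=> y My x _ /=; exact: le_trans (fM x) (ltW My).
Qed.

Lemma integrable_bounded d (T : measurableType d) (R : realType)
    (mu : {finite_measure set T -> \bar R}) (f : T -> R)
    (M : R) : measurable_fun setT f -> (forall x, `|f x| <= M) ->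
  mu.-integrable setT (EFin \o f).
Proof.
by apply: integrable_bounded_lty; rewrite ltey_eq fin_num_measure.
Qed.

Lemma measurable_invr (R : realType) : measurable_fun setT (fun x : R => x^-1).
Proof.
rewrite (_ : (fun x => _) = (fun x : R => if 0 <= x then x `^ (-1) else - ((- x) `^ (-1)))).
  apply: measurable_fun_ifT; first exact: measurable_fun_ler.
    exact: measurable_powR.
  apply: measurableT_comp => //.
  exact: (@measurableT_comp _ _ _ _ _ _ (@powR R ^~ (-1))).
apply/funext => x; case: ifPn => [x0|]; first by rewrite powR_inv1.
by rewrite -ltNge => x0; rewrite powR_inv1 ?invrN ?opprK// oppr_ge0 ltW.
Qed.

Section density.
Local Open Scope ereal_scope.
Context d (T : measurableType d) (R : realType).
Variables (m : {measure set T -> \bar R}) (h : T -> R).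

Definition density (mh : measurable_fun setT h) (h0 : forall x, (0 <= h x)%R)
  (A : set T) : \bar R := \int[m]_(x in A) (h x)%:E.

Variables (mh : measurable_fun setT h) (h0 : forall x, (0 <= h x)%R).

Let density_set0 : density mh h0 set0 = 0.
Proof. exact: integral_set0. Qed.

Let density_ge0 A : 0 <= density mh h0 A.
Proof. by apply: integral_ge0 => x _; rewrite lee_fin. Qed.

Let density_sigma_additive : semi_sigma_additive (density mh h0).
Proof.
move=> F mF tF mUF; rewrite /density ge0_integral_bigcup//; last 2 first.
  by apply/measurable_EFinP; exact: measurable_funTS.
  by move=> x _; rewrite lee_fin.
by apply: is_cvg_nneseries => n _ _; exact: density_ge0.
Qed.

HB.instance Definition _ := isMeasure.Build _ _ _ (density mh h0)
  density_set0 density_ge0 density_sigma_additive.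

Import HBNNSimple.

Lemma ge0_integral_density (F : T -> \bar R) :
  measurable_fun setT F -> (forall x, 0 <= F x) ->
  \int[density mh h0]_x F x = \int[m]_x (F x * (h x)%:E).
Proof.
move=> mF F0.
have mhE : measurable_fun setT (EFin \o h) by exact/measurable_EFinP.
pose g := nnsfun_approx measurableT mF.
have gE n : \int[density mh h0]_x (g n x)%:E = \int[m]_x ((g n x)%:E * (h x)%:E).
  under [LHS]eq_integral do rewrite fimfunE -fsumEFin//.
  rewrite ge0_integral_fsum//; last 2 first.
  - by move=> r; exact/measurable_EFinP/measurable_funM.
  - by move=> r x _; rewrite EFinM nnfun_muleindic_ge0.
  under [RHS]eq_integral.
    move=> x _; rewrite fimfunE -fsumEFin// ge0_mule_fsuml; last first.
      by move=> r; rewrite EFinM nnfun_muleindic_ge0.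
    over.
  rewrite ge0_integral_fsum//; last 2 first.
  - move=> r; apply: emeasurable_funM => //.
    exact/measurable_EFinP/measurable_funM.
  - by move=> r x _; rewrite mule_ge0 ?lee_fin// -lee_fin EFinM nnfun_muleindic_ge0.
  apply: eq_fsbigr => r rg.
  rewrite integralZl_indic_nnsfun// integral_indic//= setIT.
  have [r0|r0] := ltP r 0%R.
    rewrite preimage_nnfun0// measure0 mule0 integral0_eq// => x _.
    by rewrite indic0 mulr0 mul0e.
  under [RHS]eq_integral do rewrite EFinM -muleA.
  rewrite ge0_integralZl//; last 2 first.
  - by apply: emeasurable_funM => //; exact/measurable_EFinP.
  - by move=> x _; rewrite mule_ge0 ?lee_fin.
  congr (_ * _); rewrite /density integral_mkcond; apply: eq_integral => x _.
  by rewrite epatch_indic muleC.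
transitivity (limn (fun n => \int[density mh h0]_x (g n x)%:E)).
  rewrite -monotone_convergence//.
  - by apply: eq_integral => x _; apply/esym/cvg_lim => //; exact: cvg_nnsfun_approx.
  - by move=> n; exact/measurable_EFinP.
  - by move=> n x _; rewrite lee_fin.
  - by move=> x _ a b ab; rewrite lee_fin; exact/lefP/nd_nnsfun_approx.
under eq_fun do rewrite gE.
rewrite -monotone_convergence//.
- apply: eq_integral => x _; apply/cvg_lim => //; apply: cvgeZr => //.
  exact: cvg_nnsfun_approx.
- by move=> n; apply: emeasurable_funM => //; exact/measurable_EFinP.
- by move=> n x _; rewrite mule_ge0 ?lee_fin.
- move=> x _ a b ab; rewrite lee_wpmul2r ?lee_fin//.
  exact/lefP/nd_nnsfun_approx.
Qed.

End density.

(** For a measure [n] that is not literally a [density], such as a [mnormalize] or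
    a [mdiff]. *)
Lemma ge0_integral_dominated d (T : measurableType d) (R : realType)
    (m n : {measure set T -> \bar R}) (h : T -> R) (D : set T)
    (F : T -> \bar R) :
  measurable_fun setT h -> (forall x, 0 <= h x) ->
  (forall A, measurable A -> n A = \int[m]_(x in A) (h x)%:E)%E ->
  measurable D -> measurable_fun setT F -> (forall x, 0 <= F x)%E ->
  (\int[n]_(x in D) F x = \int[m]_(x in D) (F x * (h x)%:E))%E.
Proof.
move=> mh h0 nE mD mF F0; rewrite integral_mkcond [RHS]integral_mkcond.
rewrite (eq_measure_integral (density m mh h0)); last by move=> A mA _; exact: nE.
rewrite ge0_integral_density//.
- by apply: eq_integral => x _; rewrite !patchE; case: ifPn; rewrite ?mul0e.
- by apply/(measurable_restrictT _ _).1 => //; exact: measurable_funTS.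
- by move=> x; rewrite patchE; case: ifPn.
Qed.

(** Adding a constant to the bounded function [F] makes it nonnegative. *)
Lemma integral_dominated d (T : measurableType d) (R : realType)
    (m n : {measure set T -> \bar R}) (h F : T -> R) (C M : R) :
  (m setT < +oo)%E -> measurable_fun setT h -> (forall x, 0 <= h x <= C) ->
  (forall A, measurable A -> n A = \int[m]_(x in A) (h x)%:E)%E ->
  measurable_fun setT F -> (forall x, `|F x| <= M) ->
  (\int[n]_x (F x)%:E = \int[m]_x (F x * h x)%:E)%E.
Proof.
move=> moo mh hC nE mF FM.
have h0 x : 0 <= h x by have /andP[] := hC x.
have hC' x : `|h x| <= C by rewrite ger0_norm//; have /andP[] := hC x.
have ih := integrable_bounded_lty moo mh hC'.
have iMh : m.-integrable setT (EFin \o (fun x => M * h x)).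
  exact: (integrableZl measurableT M ih).
have FhMC x : `|F x * h x| <= M * C by rewrite normrM ler_pM.
have iFh := integrable_bounded_lty moo (measurable_funM mF mh) FhMC.
have nT : n setT = (\int[m]_x (h x)%:E)%E by exact: nE.
have hfin : (\int[m]_x (h x)%:E)%E \is a fin_num := integrable_fin_num measurableT ih.
have noo : (n setT < +oo)%E by rewrite nT ltey_eq hfin.
have iF := integrable_bounded_lty noo mF FM.
have iM : n.-integrable setT (EFin \o cst M).
  by apply: (integrable_bounded_lty (M := `|M|) noo).
have mFM : measurable_fun setT (fun x => (F x + M)%:E).
  by apply/measurable_EFinP; exact: measurable_funD.
have FM0 x : (0 <= (F x + M)%:E)%E.
  rewrite lee_fin -lerBlDr sub0r lerNl; apply: le_trans (FM x).
  by rewrite -normrN ler_norm.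
have := ge0_integral_dominated mh h0 nE measurableT mFM FM0.
have -> : (\int[n]_x (F x + M)%:E = \int[n]_x (F x)%:E + M%:E * n setT)%E.
  transitivity (\int[n]_x ((EFin \o F) x + (EFin \o cst M) x))%E; first by [].
  rewrite (integralD measurableT iF iM); congr (_ + _)%E.
  exact: (integral_cst n measurableT M%:E).
have -> : (\int[m]_x ((F x + M)%:E * (h x)%:E) =
    \int[m]_x (F x * h x)%:E + M%:E * n setT)%E.
  transitivity (\int[m]_x ((EFin \o (fun x => F x * h x)%R) x +
      (EFin \o (fun x => M * h x)%R) x))%E.
    by apply: eq_integral => x _; rewrite -EFinM mulrDl EFinD.
  rewrite (integralD measurableT iFh iMh); congr (_ + _)%E.
  by rewrite (integralZl measurableT ih) nT.
move=> /(congr1 (fun z => z - M%:E * n setT)%E).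
by rewrite !addeK// fin_numM// nT.
Qed.

Section ae_integral.
Local Open Scope ereal_scope.
Context d (T : measurableType d) (R : realType).
Implicit Types mu nu : {measure set T -> \bar R}.

Lemma ae_le_integral mu (f g : T -> \bar R) :
  measurable_fun setT f -> measurable_fun setT g ->
  {ae mu, forall x, f x <= g x} -> \int[mu]_x f x <= \int[mu]_x g x.
Proof.
move=> mf mg fg; rewrite integralE [leRHS]integralE leeB//.
- apply: ae_ge0_le_integral => //.
  + exact: measurable_funepos.
  + exact: measurable_funepos.
  + apply: filterS fg => x fgx _; rewrite !funeposE.
    by rewrite ge_max !le_max fgx lexx orbT.
- apply: ae_ge0_le_integral => //.
  + exact: measurable_funeneg.
  + exact: measurable_funeneg.
  + apply: filterS fg => x fgx _; rewrite !funenegE.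
    by rewrite ge_max !le_max leeN2 fgx lexx orbT.
Qed.

Lemma measurable_lne_EFin (f : T -> R) : measurable_fun setT f ->
  measurable_fun setT (fun x => lne (f x)%:E).
Proof.
move=> mf.
rewrite (_ : (fun x => _) =
  (fun x => if (f x <= 0)%R then -oo else (ln (f x))%:E)) //.
apply: measurable_fun_ifT => //.
- exact: measurable_fun_ler.
- by apply/measurable_EFinP; exact: measurableT_comp.
Qed.

End ae_integral.

(** * Bounds on the Kullback-Leibler divergence *)

Section KL_bounds.
Local Open Scope ereal_scope.
Context d (T : measurableType d) (R : realType).
Implicit Types (nu mu : probability T R).

(** The density can be chosen real-valued and nonnegative everywhere, so that
    logarithms can be compared pointwise. *)
Lemma KL_density nu mu : nu `<< mu ->
  exists rho : T -> R, [/\ measurable_fun setT rho, forall x, (0 <= rho x)%R,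
    forall A, measurable A -> nu A = \int[mu]_(x in A) (rho x)%:E &
    KL nu mu = \int[nu]_x lne (rho x)%:E].
Proof.
move=> numu; pose f := Radon_Nikodym_SigmaFinite.f nu mu.
pose g := Radon_Nikodym (charge_of_finite_measure nu) mu.
have fE x : f x = (fine (f x))%:E.
  by rewrite fineK//; exact: Radon_Nikodym_SigmaFinite.f_fin_num.
have gE x : g x = (fine (g x))%:E by rewrite fineK//; exact: Radon_Nikodym_fin_num.
have mf : measurable_fun setT f.
  by have /integrableP[] := Radon_Nikodym_SigmaFinite.f_integrable numu.
have mg : measurable_fun setT g.
  have : mu.-integrable setT g by exact: Radon_Nikodym_integrable.
  by move=> /integrableP[].
exists (fine \o f); split.
- exact: measurableT_comp.
- by move=> x; rewrite fine_ge0//; exact: Radon_Nikodym_SigmaFinite.f_ge0.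
- move=> A mA; rewrite (Radon_Nikodym_SigmaFinite.f_integral numu mA).
  by apply: eq_integral => x _ /=; rewrite -fE.
- rewrite /KL asboolT//; apply: ae_eq_integral => //.
  + rewrite (_ : (fun x => _) = (fun x => lne (fine (g x))%:E)).
      by apply: measurable_lne_EFin; exact: measurableT_comp.
    by apply/funext => x; rewrite -gE.
  + by apply: measurable_lne_EFin; exact: measurableT_comp.
  + have := ae_eq_Radon_Nikodym_SigmaFinite numu measurableT.
    move=> /(null_dominates_ae_eq measurableT numu).
    apply: filterS => x fgx _.
    by rewrite -(fgx I); congr lne; exact: fE.
Qed.

(** If [mu] dominates [h nu] then [d nu / d mu <= 1 / h] holds [nu]-a.e. *)
Lemma KL_le nu mu (h : T -> R) (c C : R) : measurable_fun setT h ->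
  (0 < c)%R -> (forall x, c <= h x <= C)%R ->
  (forall A, measurable A -> \int[nu]_(x in A) (h x)%:E <= mu A) ->
  KL nu mu <= \int[nu]_x (- ln (h x))%:E.
Proof.
move=> mh c0 hcC hle.
have h0 x : (0 < h x)%R by have /andP[ch _] := hcC x; exact: lt_le_trans ch.
have numu : nu `<< mu.
  move=> A muA0 B mB BA; have muB0 : mu B = 0 by exact: muA0.
  have : c%:E * nu B <= 0.
    rewrite -muB0; apply: le_trans (hle _ mB).
    rewrite -integral_cst//; apply: ge0_le_integral => //.
    - by move=> x _; rewrite lee_fin ltW.
    - by apply/measurable_EFinP; exact: measurable_funTS.
    - by move=> x _; rewrite lee_fin; have /andP[] := hcC x.
  by rewrite pmule_rle0 ?lte_fin// => ?; apply/eqP; rewrite eq_le measure_ge0 andbT.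
have [rho [mrho rho0 nuE ->]] := KL_density numu.
apply: ae_le_integral.
- exact: measurable_lne_EFin.
- by apply/measurable_EFinP; apply: measurableT_comp => //; exact: measurableT_comp.
(* where [h rho > 1], domination gives [\int (h rho - 1) d mu <= 0] *)
pose A := [set x | (1 < h x * rho x)%R].
have mA : measurable A.
  rewrite -[A]setTI; apply: (measurable_fun_ltr (f := cst 1%R)) => //.
  exact: measurable_funM.
suff nuA : nu A = 0.
  exists A; split => // x /=; apply: contra_notP => /negP.
  rewrite /A/= -leNgt => hrho.
  have [r0|r0] := leP (rho x) 0%R; first by rewrite leNye.
  rewrite lee_fin -lnV ?posrE// ler_ln ?posrE ?invr_gt0//.
  by rewrite -[leRHS]mul1r ler_pdivlMr// mulrC.
have hrhoE : \int[nu]_(x in A) (h x)%:E = \int[mu]_(x in A) (h x * rho x)%:E.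
  rewrite (ge0_integral_dominated mrho rho0 nuE)//; first exact/measurable_EFinP.
  by move=> x; rewrite lee_fin ltW.
have hi : mu.-integrable A (EFin \o (fun x => h x * rho x)%R).
  apply/integrableP; split.
    by apply/measurable_EFinP; apply: measurable_funTS; exact: measurable_funM.
  under eq_integral do rewrite /= ger0_norm ?mulr_ge0// ?ltW//.
  rewrite -hrhoE; apply: le_lt_trans (hle _ mA) _.
  by rewrite ltey_eq fin_num_measure.
have i1 : mu.-integrable A (EFin \o cst 1%R).
  exact: finite_measure_integrable_cst.
have q0 : \int[mu]_(x in A) `|(EFin \o (fun x => h x * rho x)%R) x - 1| = 0.
  apply/eqP; rewrite eq_le; apply/andP; split; last exact: integral_ge0.
  under eq_integral.
    move=> x; rewrite inE /A/= => Ax.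
    rewrite ger0_norm ?subr_ge0 ?ltW// EFinB.
    over.
  rewrite (integralB mA hi i1)//= -hrhoE integral_cst// mul1e.
  by rewrite leeBlDr ?fin_num_measure// add0e; exact: hle.
have muA : mu A = 0.
  have [|+ _] := @ae_eq_integral_abs _ _ _ mu A mA
      (fun x => (EFin \o (fun x => h x * rho x)%R) x - 1).
    apply/measurable_EFinP; apply: measurable_funB => //; apply: measurable_funTS.
    exact: measurable_funM.
  case/(_ q0) => N [mN N0 AN].
  apply: (subset_measure0 mA mN) => // x Ax.
  apply: AN => /= /(_ Ax)/eqP; rewrite -EFinB eqe subr_eq0 => /eqP e1.
  by move: Ax; rewrite /A/= e1 ltxx.
apply: (numu A) => // B mB BA; exact: subset_measure0 muA.
Qed.

(** The easy half of the Donsker-Varadhan formula, from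
    [ln r >= g + 1 - e^g / r]. *)
Lemma KL_ge nu mu (g : T -> R) (M : R) : measurable_fun setT g ->
  (forall x, `|g x| <= M)%R -> \int[mu]_x (expR (g x))%:E <= 1 ->
  \int[nu]_x (g x)%:E <= KL nu mu.
Proof.
move=> mg gM gmu.
have [numu|nnumu] := pselect (nu `<< mu); last first.
  by rewrite /KL asboolF// leey.
have [rho [mrho rho0 nuE ->]] := KL_density numu.
pose w x := if (rho x <= 0)%R then 0%R else expR (g x - ln (rho x)).
have wE x : (0 < rho x)%R -> w x = (expR (g x) / rho x)%R.
  by move=> r0; rewrite /w leNgt r0/= expRD expRN lnK.
have mw : measurable_fun setT w.
  apply: measurable_fun_ifT => //; first exact: measurable_fun_ler.
  apply: measurableT_comp => //; apply: measurable_funB => //.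
  exact: measurableT_comp.
have w0 x : (0 <= w x)%R by rewrite /w; case: ifP => // _; exact: expR_ge0.
have intw : \int[nu]_x (w x)%:E <= 1.
  rewrite (ge0_integral_dominated mrho rho0 nuE)//; last exact/measurable_EFinP.
  apply: le_trans gmu; apply: ge0_le_integral => //.
  - by move=> x _; rewrite mule_ge0// lee_fin.
  - by apply/measurable_EFinP; exact: measurable_funM.
  - by apply/measurable_EFinP; exact: measurableT_comp.
  - move=> x _; rewrite -EFinM lee_fin; have [r0|r0] := leP (rho x) 0%R.
      by rewrite /w r0 mul0r expR_ge0.
    by rewrite wE// divfK// gt_eqF.
have iw : nu.-integrable setT (EFin \o w).
  apply/integrableP; split; first exact/measurable_EFinP.
  under eq_integral do rewrite /= ger0_norm//.
  by apply: le_lt_trans intw _; rewrite ltry.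
have ig := integrable_bounded nu mg gM.
have i1 : nu.-integrable setT (EFin \o cst 1%R).
  exact: finite_measure_integrable_cst.
apply: (@le_trans _ _ (\int[nu]_x (g x + 1 - w x)%:E)).
  under [leRHS]eq_integral do rewrite EFinB EFinD.
  rewrite integralB//; last exact: integrableD.
  rewrite /= (integralD measurableT ig i1).
  have -> : \int[nu]_x (EFin \o cst 1%R) x = 1.
    exact: integral_cst_probability.
  rewrite -addeA leeDl// sube_ge0//.
  by rewrite (integrable_fin_num measurableT iw).
apply: ae_le_integral.
- by apply/measurable_EFinP; apply: measurable_funB => //; exact: measurable_funD.
- exact: measurable_lne_EFin.
have m0 : measurable [set x | (rho x <= 0)%R].
  rewrite -[X in measurable X]setTI; apply: (measurable_fun_ler (g := cst 0%R)) => //.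
exists [set x | (rho x <= 0)%R]; split => //.
  apply: (etrans (nuE _ m0)); apply: integral0_eq => x /= rx0; congr EFin; apply/eqP.
  by rewrite eq_le rx0 rho0.
move=> x /=; apply: contra_notP => /negP; rewrite -ltNge => r0.
rewrite [(rho x <= 0)%R]leNgt r0/= lee_fin wE//.
have := le_ln1Dx (x := expR (g x) / rho x - 1).
rewrite [(1 + _)%R]addrC subrK ln_div ?posrE ?expR_gt0// expRK.
have r1 : (0 < expR (g x) / rho x)%R by rewrite divr_gt0// expR_gt0.
by move=> lnle; have := lnle ltac:(lra); lra.
Qed.

End KL_bounds.

(** * Duality for the constrained minimum of the divergence *)

Definition tilt (T : Type) (R : realType) (f : T -> R) (u l : R) (x : T) : R :=
  1 - l * (f x - u).

Section tilt.
Context d (T : measurableType d) (R : realType).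
Variables (f : T -> R) (u B Y l : R).
Hypotheses (mf : measurable_fun setT f) (yB : forall x, `|f x - u| <= B)
  (yY : forall x, f x - u <= Y) (l0 : 0 <= l) (lY : l * Y < 1).

Lemma tilt_ge x : 1 - l * Y <= tilt f u l x.
Proof. by rewrite lerD2l lerN2 ler_wpM2l. Qed.

Lemma tilt_le x : tilt f u l x <= 1 + l * B.
Proof.
rewrite lerD2l -mulrN ler_wpM2l//.
by have := yB x; rewrite ler_norml lerNl => /andP[].
Qed.

Lemma tilt_gt0 x : 0 < tilt f u l x.
Proof. by apply: lt_le_trans (tilt_ge x); rewrite subr_gt0. Qed.

Lemma measurable_tilt : measurable_fun setT (tilt f u l).
Proof.
apply: measurable_funB => //; apply: measurable_funM => //.
exact: measurable_funB.
Qed.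

Lemma measurable_ln_tilt : measurable_fun setT (fun x => ln (tilt f u l x)).
Proof. by apply: measurableT_comp => //; exact: measurable_tilt. Qed.

Lemma ln_tilt_bounded x :
  `|ln (tilt f u l x)| <= `|ln (1 - l * Y)| + `|ln (1 + l * B)|.
Proof.
have lY0 : 0 < 1 - l * Y by rewrite subr_gt0.
have t0 := tilt_gt0 x.
have l1 : ln (1 - l * Y) <= ln (tilt f u l x) by rewrite ler_ln ?posrE// tilt_ge.
have l2 : ln (tilt f u l x) <= ln (1 + l * B).
  by rewrite ler_ln ?posrE// ?tilt_le//; exact: lt_le_trans (tilt_le x).
rewrite ler_norml; apply/andP; split.
  rewrite (le_trans _ l1)// (le_trans (y := - `|ln (1 - l * Y)|))//.
    by rewrite lerN2 lerDl.
  by rewrite lerNl -normrN ler_norm.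
by rewrite (le_trans l2)// (le_trans (ler_norm _))// lerDr.
Qed.

Lemma integrable_ln_tilt (m : {finite_measure set T -> \bar R}) :
  m.-integrable setT (EFin \o (fun x => ln (tilt f u l x))).
Proof. exact: integrable_bounded measurable_ln_tilt ln_tilt_bounded. Qed.

Lemma measurable_tiltV : measurable_fun setT (fun x => (tilt f u l x)^-1).
Proof.
apply: (@measurableT_comp _ _ _ _ _ _ (@GRing.inv R)).
  exact: measurable_invr.
exact: measurable_tilt.
Qed.

Lemma tiltV_bounds x : (1 + l * B)^-1 <= (tilt f u l x)^-1 <= (1 - l * Y)^-1.
Proof.
have t0 := tilt_gt0 x.
have lY0 : 0 < 1 - l * Y by rewrite subr_gt0.
have lB0 : 0 < 1 + l * B := lt_le_trans t0 (tilt_le x).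
by rewrite !lef_pV2 ?posrE// tilt_le tilt_ge.
Qed.

End tilt.

Section Kinf_dual.
Context d (T : measurableType d) (R : realType).
Variables (nu : probability T R) (f : T -> R) (u B Y : R) (x0 : T).
Hypotheses (mf : measurable_fun setT f) (yB : forall x, `|f x - u| <= B)
  (yY : forall x, f x - u <= Y) (Y0 : 0 < Y) (yx0 : f x0 - u = Y).

Let y x := f x - u.

Let my : measurable_fun setT y.
Proof. by apply: measurable_funB. Qed.

Let B_ge0 : 0 <= B.
Proof. exact: le_trans (normr_ge0 _) (yB x0). Qed.

(** The law [h nu + r dirac x0].  Since [f x0 - u = Y], the atom adds [r Y] to
    the excess of the mean of [f] over [u]. *)
Lemma mixture_law (h : T -> R) (r C : R) : measurable_fun setT h ->
  (forall x, 0 <= h x <= C) -> 0 <= r -> \int[nu]_x h x + r = 1 ->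
  exists mu : probability T R,
    (forall A, measurable A -> \int[nu]_(x in A) (h x)%:E <= mu A)%E /\
    ('E_mu[f] = (u + \int[nu]_x (y x * h x) + r * Y)%:E)%E.
Proof.
move=> mh hC r0 hr.
have h0 x : 0 <= h x by have /andP[] := hC x.
have habs x : `|h x| <= C by rewrite ger0_norm//; have /andP[] := hC x.
have ih := integrable_bounded nu mh habs.
have hE : (\int[nu]_x (h x)%:E = (\int[nu]_x h x)%:E)%E.
  by rewrite fineK//; exact: (integrable_fin_num measurableT ih).
pose m1 := density nu mh h0.
pose m2 := mscale (NngNum r0) (dirac x0 : {measure set T -> \bar R}).
pose m := measure_add m1 m2.
have mE A : m A = (\int[nu]_(x in A) (h x)%:E + r%:E * \d_x0 A)%E.
  by rewrite /m measure_addE.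
have mT : m setT = 1%E by rewrite mE diracT mule1 hE -EFinD hr.
pose mu : probability T R := mnormalize m nu.
have muE A : mu A = m A by exact: mnormalize1E.
exists mu; split.
  by move=> A mA; rewrite muE mE leeDl// mule_ge0.
pose F x := (y x + B)%:E.
have mF : measurable_fun setT F.
  by apply/measurable_EFinP; exact: measurable_funD.
have F0 x : (0 <= F x)%E.
  by rewrite lee_fin -lerBlDr sub0r lerNl; have := yB x; rewrite ler_norml => /andP[]; rewrite lerNl.
have EF : (\int[mu]_x F x = (\int[nu]_x (y x * h x) + r * Y + B)%:E)%E.
  transitivity (\int[m]_x F x)%E; first by apply: eq_measure_integral => A _ _; exact: muE.
  rewrite ge0_integral_measure_add//.
  rewrite ge0_integral_density// ge0_integral_mscale// integral_dirac// diracT mul1e.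
  have yhB x : `|y x * h x| <= B * C.
    by rewrite normrM; apply: ler_pM => //; exact: yB.
  have iyh := integrable_bounded nu (measurable_funM my mh) yhB.
  under eq_integral do rewrite -EFinM mulrDl EFinD.
  have iBh : nu.-integrable setT (EFin \o (fun x => B * h x)).
    by apply: (integrableZl measurableT _ ih).
  rewrite (integralD measurableT iyh iBh).
  rewrite (integralZl measurableT ih) hE.
  rewrite -[X in (X + _ + _)%E]fineK; last exact: (integrable_fin_num measurableT iyh).
  rewrite -!EFinM -!EFinD /F -/(y x0) [y x0]yx0; congr EFin.
  have -> : \int[nu]_x h x = 1 - r by rewrite -hr addrK.
  by rewrite -[fine _]/(\int[nu]_x (y x * h x)) /=; ring.
have BmE : (\int[mu]_x (cst (u - B)%:E x) = (u - B)%:E)%E.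
  exact: integral_cst_probability.
rewrite unlock.
have bfy x : `|f x| <= B + `|u|.
  by rewrite -[f x](subrK u) (le_trans (ler_normD _ _))// lerD2r.
transitivity (\int[mu]_x (F x + (cst (u - B)%:E x)))%E.
  by apply: eq_integral => x _; rewrite /F /y -EFinD; congr EFin; ring.
rewrite integralD//; last 2 first.
- apply/integrableP; split=> //; under eq_integral do rewrite gee0_abs//.
  by rewrite EF ltry.
- exact: finite_measure_integrable_cst.
by rewrite EF BmE -EFinD; congr EFin; ring.
Qed.

(** Minus the derivative in [l] of the dual objective. *)
Let D (l : R) := \int[nu]_x (y x / tilt f u l x).

Let integrable_D (l : R) : 0 <= l -> l * Y < 1 ->
  nu.-integrable setT (EFin \o (fun x => y x / tilt f u l x)).
Proof.
move=> l0 lY; apply: (@integrable_bounded _ _ _ _ _ (B * (1 - l * Y)^-1)).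
  by apply: measurable_funM => //; exact: measurable_tiltV.
move=> x; rewrite normrM; apply: ler_pM => //; first exact: yB.
have /andP[h1 h2] := tiltV_bounds yB yY l0 lY x.
rewrite ger0_norm//; apply: le_trans h1.
by rewrite invr_ge0 addr_ge0// mulr_ge0.
Qed.

Let integrable_tiltV (l : R) : 0 <= l -> l * Y < 1 ->
  nu.-integrable setT (EFin \o (fun x => (tilt f u l x)^-1)).
Proof.
move=> l0 lY; apply: (@integrable_bounded _ _ _ _ _ ((1 - l * Y)^-1)).
  exact: measurable_tiltV.
move=> x; have /andP[h1 h2] := tiltV_bounds yB yY l0 lY x.
rewrite ger0_norm//; apply: le_trans h1.
by rewrite invr_ge0 addr_ge0// mulr_ge0.
Qed.

Let tiltV_mass (l : R) : 0 <= l -> l * Y < 1 ->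
  \int[nu]_x (tilt f u l x)^-1 = 1 + l * D l.
Proof.
move=> l0 lY; rewrite /D -(RintegralZl _ measurableT (integrable_D l0 lY)).
have -> : 1 = \int[nu]_x (cst 1 x : R).
  by rewrite Rintegral_cst// mul1r; have /= -> := probability_setT nu.
rewrite -RintegralD//; last 2 first.
- exact: finite_measure_integrable_cst.
- by have := integrableZl measurableT l (integrable_D l0 lY).
apply: eq_Rintegral => x _.
have t0 := tilt_gt0 yY l0 lY x.
rewrite /= mulrA -[X in _ = X + _](divff (lt0r_neq0 t0)) -mulrDl.
by rewrite [X in X + _]/tilt -/(y x) subrK mul1r.
Qed.

(** A primal candidate: [(1 - t) nu / tilt], completed by an atom at a maximum
    of [f]. *)
Let Kinf_le_mixture (l t : R) (r := 1 - (1 - t) * (1 + l * D l)) :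
  0 <= l -> l * Y < 1 -> 0 <= t < 1 -> 0 <= r -> 0 <= (1 - t) * D l + r * Y ->
  (Kinf nu u f <= \int[nu]_x (ln (tilt f u l x))%:E + (- ln (1 - t))%:E)%E.
Proof.
move=> l0 lY /andP[t0 t1] r0 mean0.
pose h x := (1 - t) * (tilt f u l x)^-1.
have t1' : 0 < 1 - t by rewrite subr_gt0.
have mh : measurable_fun setT h.
  by apply: measurable_funM => //; exact: measurable_tiltV.
have lB0 : 0 < 1 + l * B by rewrite ltr_pwDl// mulr_ge0.
have hC x : (1 - t) * (1 + l * B)^-1 <= h x <= (1 - t) * (1 - l * Y)^-1.
  by rewrite !ler_pM2l//; exact: tiltV_bounds.
have c0 : 0 < (1 - t) * (1 + l * B)^-1 by rewrite mulr_gt0// invr_gt0.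
have hC0 x : 0 <= h x <= (1 - t) * (1 - l * Y)^-1.
  by have /andP[h1 ->] := hC x; rewrite andbT (le_trans (ltW c0)).
have hmass : \int[nu]_x h x + r = 1.
  by rewrite RintegralZl ?tiltV_mass ?subrKC//; exact: integrable_tiltV.
have [mu [mu_ge muE]] := mixture_law mh hC0 r0 hmass.
apply: (@le_trans _ _ (KL nu mu)).
  apply: ereal_inf_lbound; exists mu => //=; rewrite muE lee_fin -addrA lerDl.
  suff -> : \int[nu]_x (y x * h x) = (1 - t) * D l by [].
  rewrite -(RintegralZl _ measurableT (integrable_D l0 lY)).
  by apply: eq_Rintegral => x _; rewrite /h; ring.
apply: (le_trans (KL_le mh c0 hC mu_ge)).
have -> : (- ln (1 - t))%:E = (\int[nu]_x (cst (- ln (1 - t))%:E x))%E.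
  exact/esym/integral_cst_probability.
rewrite -integralD//; last 2 first.
- exact: (integrable_ln_tilt mf yB yY l0 lY).
- exact: finite_measure_integrable_cst.
rewrite le_eqVlt; apply/orP; left; apply/eqP; apply: eq_integral => x _.
have tx := tilt_gt0 yY l0 lY x.
rewrite -EFinD; congr EFin.
by rewrite /h lnM ?posrE ?invr_gt0// lnV ?posrE//; ring.
Qed.

(** If [D 0 >= 0], then [nu] satisfies the constraint.  If [D] takes a nonnegative
    value later, it vanishes at some [l] and [nu / tilt l] is a probability of
    mean exactly [u].  If [D] stays negative, then [nu / tilt l] has mass less
    than 1; for [l] close to [1 / Y], shrinking it slightly and putting the
    missing mass at [x0] meets the constraint, at a cost which tends to 0. *)
Lemma Kinf_le_dual (M : \bar R) :
  (forall l : R, 0 <= l -> l * Y < 1 ->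
    (\int[nu]_x (ln (tilt f u l x))%:E <= M)%E) ->
  (Kinf nu u f <= M)%E.
Proof.
move=> HM.
have [D0|D0] := leP 0 (D 0).
  apply: le_trans (HM 0 (lexx 0) _); last by rewrite mul0r ltr01.
  have := @Kinf_le_mixture 0 0; rewrite subr0 ln1 oppr0 adde0; apply => //.
  - by rewrite mul0r.
  - by rewrite lexx/=.
  - by rewrite mul0r addr0 mulr1 subrr.
  - by rewrite mul1r mul0r addr0 mulr1 subrr mul0r addr0.
have [[l [l0 lY Dl]]|noD] := pselect (exists l, [/\ 0 <= l, l * Y < 1 & 0 <= D l]).
  have [l' [l'0 l'Y Dl'0]] : exists l', [/\ 0 <= l', l' * Y < 1 & D l' = 0].
    have [b [b0 lb bY]] : exists b, [/\ 0 < b, l < b & b * Y < 1].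
      exists ((l + Y^-1) / 2); move: lY; rewrite -ltr_pdivlMr// mul1r => lY.
      have Yi : 0 < Y^-1 by rewrite invr_gt0.
      split; [lra|lra|rewrite -ltr_pdivlMr// mul1r; lra].
    (* [D] is continuous on a neighborhood of [[0, l]]: there [tilt] stays above
       the positive constant [k] below *)
    pose a := - (2 * B + 1)^-1.
    have a0 : a < 0 by rewrite oppr_lt0 invr_gt0 ltr_wpDl// mulr_ge0.
    have contD : {in `]a, b[%classic, continuous D}.
      pose k := Num.min (2^-1) (1 - b * Y).
      have k0 : 0 < k by rewrite lt_min invr_gt0 ltr0n subr_gt0.
      have tk (s : R) x : `]a, b[%classic s -> k <= tilt f u s x.
        rewrite /= in_itv/= => /andP[sa sb]; rewrite ge_min.
        have [s0|s0] := leP 0 s; apply/orP; [right|left].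
          by apply: le_trans (tilt_ge yY s0 x); rewrite lerD2l lerN2 ler_wpM2r// ltW.
        rewrite /tilt.
        have aB : - a * B <= 2^-1.
          by have B0 := B_ge0; rewrite opprK mulrC ler_pdivrMr; lra.
        have : s * y x <= - a * B.
          apply: le_trans (ler_norm _) _; rewrite normrM ler_pM//; last exact: yB.
          by rewrite ltr0_norm// lerN2 ltW.
        by rewrite /y; lra.
      have yk (s : R) x : `]a, b[%classic s -> `|y x / tilt f u s x| <= B / k.
        move=> sab; have ks := tk s x sab; rewrite normrM ler_pM//; first exact: yB.
        have ts : 0 < tilt f u s x by exact: lt_le_trans ks.
        by rewrite ger0_norm ?lef_pV2 ?posrE ?invr_ge0// ltW.
      apply: (@continuity_under_integral _ _ _ nu _ _ measurableT a b _ _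
        (cst (B / k))).
      - move=> s abs; apply: (@integrable_bounded _ _ _ _ _ (B / k)).
          by apply: measurable_funM => //; exact: measurable_tiltV.
        by move=> x; exact: yk.
      - apply: aeW => x _ s /set_mem abs.
        have ts : tilt f u s x != 0 by rewrite gt_eqF// (lt_le_trans k0)//; exact: tk.
        apply: cvgM; first exact: cvg_cst.
        apply: cvgV => //; apply: cvgB; first exact: cvg_cst.
        by apply: cvgM; [exact: cvg_id|exact: cvg_cst].
      - exact: finite_measure_integrable_cst.
      - by move=> s abs; apply: aeW => x _; exact: yk.
    have [|| l' l'01 Dl'] := @IVT R D 0 l 0 l0.
    - apply: continuous_in_subspaceT => x; rewrite inE/= in_itv/= => /andP[x0' xl].
      by apply: contD; rewrite inE/= in_itv/= (lt_le_trans a0)// (le_lt_trans xl).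
    - by rewrite ge_min le_max (ltW D0) Dl orbT.
    move: l'01; rewrite in_itv/= => /andP[l'0 l'l].
    by exists l'; split=> //; apply: le_lt_trans lY; rewrite ler_pM2r.
  apply: le_trans (HM l' l'0 l'Y).
  have := @Kinf_le_mixture l' 0; rewrite subr0 ln1 oppr0 adde0; apply => //.
  - by rewrite lexx/=.
  - by rewrite Dl'0 mulr0 addr0 mulr1 subrr.
  - by rewrite Dl'0 !mulr0 addr0 mulr1 subrr mul0r addr0.
apply/lee_addgt0Pr => e e0.
(* the factor [1 - t] costs [- ln (1 - t) = e] *)
pose t := 1 - expR (- e).
have et0 : 0 < expR (- e) by exact: expR_gt0.
have t01 : 0 < t < 1.
  by rewrite /t subr_gt0 ltrBlDr ltrDl et0 andbT -expR0 ltr_expR oppr_lt0.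
have /andP[t0 t1] := t01.
pose l := (1 - t) / Y.
have lYE : l * Y = 1 - t by rewrite /l divfK// gt_eqF.
have l0 : 0 < l by rewrite divr_gt0// subr_gt0.
have lY : l * Y < 1 by rewrite lYE ltrBlDr ltrDl.
have Dl : D l < 0.
  by rewrite ltNge; apply/negP => Dl; apply: noD; exists l; split=> //; exact: ltW.
have mass0 : 0 <= 1 + l * D l.
  rewrite -tiltV_mass//; last exact: ltW.
  apply: Rintegral_ge0 => x _; rewrite invr_ge0.
  by apply/ltW; apply: (tilt_gt0 yY (ltW l0) lY).
apply: (le_trans (Kinf_le_mixture (ltW l0) lY (t := t) _ _ _)).
- by rewrite ltW//=.
- rewrite subr_ge0 mulr_ile1//; first by rewrite subr_ge0 ltW.
  + by rewrite lerBlDr lerDl ltW.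
  + by rewrite gerDl nmulr_lle0// ltW.
- have -> : (1 - t) * D l + (1 - (1 - t) * (1 + l * D l)) * Y =
     t * Y * (1 + l * D l).
    have -> : t = 1 - l * Y by rewrite lYE subKr.
    by ring.
  by apply: mulr_ge0 => //; apply: mulr_ge0; exact: ltW.
- apply: leeD; first by apply: HM => //; exact: ltW.
  by rewrite lee_fin /t subKr expRK opprK.
Qed.

(** [tilt] is affine in [f], so its integral against [mu] is at most 1 under the
    constraint, and its logarithm is a test function in [KL_ge]. *)
Lemma dual_le_Kinf (l : R) : 0 <= l -> l * Y < 1 ->
  (\int[nu]_x (ln (tilt f u l x))%:E <= Kinf nu u f)%E.
Proof.
move=> l0 lY; apply: le_ereal_inf_tmp => _ [mu /= uf <-].
apply: (@KL_ge _ _ _ nu mu _ _ (measurable_ln_tilt u l mf)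
  (ln_tilt_bounded yB yY l0 lY)).
have fb x : `|f x| <= B + `|u|.
  by rewrite -[f x](subrK u) (le_trans (ler_normD _ _))// lerD2r.
have i_f := integrable_bounded mu mf fb.
have il : mu.-integrable setT (EFin \o (fun x => l * f x)).
  exact: (integrableZl measurableT l i_f).
have ic : mu.-integrable setT (EFin \o cst (1 + l * u)).
  exact: finite_measure_integrable_cst.
have -> : (\int[mu]_x (expR (ln (tilt f u l x)))%:E =
    \int[mu]_x ((EFin \o cst (1 + l * u)%R) x - (EFin \o (fun x => l * f x)%R) x))%E.
  apply: eq_integral => x _; rewrite lnK ?posrE; last exact: (tilt_gt0 yY l0 lY).
  by rewrite -EFinB; congr EFin; rewrite /tilt /=; ring.
rewrite (integralB measurableT ic il).
rewrite (integralZl measurableT i_f).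
have -> : (\int[mu]_x (EFin \o cst (1 + l * u)%R) x = (1 + l * u)%:E)%E.
  exact: integral_cst_probability.
rewrite -[X in (_ - _ * X)%E]fineK; last exact: (integrable_fin_num measurableT i_f).
rewrite -EFinM -EFinB lee_fin.
move: uf; rewrite unlock -[X in (_ <= X)%E]fineK; last exact: (integrable_fin_num measurableT i_f).
rewrite lee_fin => uf.
by rewrite lerBlDr lerD2l ler_wpM2l.
Qed.

End Kinf_dual.

(** * Gamma laws *)

Section lebesgue_scaling.
Local Open Scope ereal_scope.
Context {R : realType}.
Notation mu := (@lebesgue_measure R).

Lemma lebesgue_measure_scale (c : R) (A : set R) : (0 < c)%R -> measurable A ->
  pushforward mu ( *%R c : _ -> measurableTypeR R) A = c^-1%:E * mu A.
Proof.
move=> c0 mA.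
have mc : measurable_fun setT ( *%R c : measurableTypeR R -> measurableTypeR R).
  exact: mulrl_measurable.
pose m := mscale (NngNum (ltW c0)) (image_measure mu mc).
suff -> : mu A = m A.
  by rewrite /m /mscale/= muleA -EFinM mulVf ?gt_eqF// mul1e.
apply: lebesgue_measure_unique mA => //= _ [[a b]] _ <-.
rewrite /m /mscale/= /pushforward/=.
rewrite (_ : _ @^-1` _ = `](a / c)%R, (b / c)%R]%classic); last first.
  apply/seteqP; split => x /=; rewrite !in_itv/= ltr_pdivrMr// ler_pdivlMr//;
    by rewrite [(x * c)%R]mulrC.
rewrite !lebesgue_measure_itv/= !lte_fin ltr_pM2r ?invr_gt0//.
case: ifPn => ab; last by rewrite mule0.
by rewrite -!EFinD -EFinM -mulrBl mulrCA divff ?gt_eqF// mulr1.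
Qed.

Lemma ge0_integral_scale (c : R) (F : R -> \bar R) : (0 < c)%R ->
  measurable_fun setT F -> (forall x, 0 <= F x) ->
  \int[mu]_(x in `]0%R, +oo[) F (c * x)%R =
  c^-1%:E * \int[mu]_(x in `]0%R, +oo[) F x.
Proof.
move=> c0 mF F0.
have mc : measurable_fun setT ( *%R c : measurableTypeR R -> measurableTypeR R).
  exact: mulrl_measurable.
have c0' : (0 <= c^-1)%R by rewrite invr_ge0 ltW.
transitivity (\int[mscale (NngNum c0') mu]_(x in `]0%R, +oo[) F x); last first.
  by rewrite ge0_integral_mscale//; exact: measurable_funTS.
transitivity (\int[image_measure mu mc]_(x in `]0%R, +oo[) F x).
  rewrite ge0_integral_image//.
  apply: congr2; last by [].
  by apply/seteqP; split => x /=; rewrite !in_itv/= !andbT pmulr_rgt0.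
by apply: eq_measure_integral => A mA _; exact: lebesgue_measure_scale.
Qed.

End lebesgue_scaling.

Section gamma_finite.
Context {R : realType}.
Notation mu := (@lebesgue_measure R).

Lemma integral_powR01 (a : R) : 0 < a ->
  (\int[mu]_(x in `]0%R, 1%R]) (x `^ (a - 1))%:E <= a^-1%:E)%E.
Proof.
move=> a0; pose e (n : nat) : R := n.+2%:R^-1.
have e0 n : 0 < e n by rewrite invr_gt0.
have e1 n : e n < 1 by rewrite invf_lt1// ltr1n.
pose F n : set R := `[e n, 1]%classic.
have seq01 : (`]0, 1]%classic : set R) = \bigcup_n F n.
  apply/seteqP; split => x.
    rewrite /= in_itv/= => /andP[x0 x1]; exists (Num.trunc x^-1) => //.
    rewrite /F/= in_itv/= x1 andbT -[leRHS]invrK lef_pV2 ?posrE ?invr_gt0//.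
    by rewrite (le_trans (ltW (truncnS_gt _)))// ler_nat.
  move=> [n _]; rewrite /F/= !in_itv/= => /andP[nx ->]; rewrite andbT.
  exact: lt_le_trans nx.
have mp : measurable_fun setT (fun x : R => (x `^ (a - 1))%:E).
  by apply/measurable_EFinP; exact: measurable_powR.
have cvgI : (\int[mu]_(x in F i) (x `^ (a - 1))%:E @[i --> \oo] -->
    \int[mu]_(x in \bigcup_i F i) (x `^ (a - 1))%:E)%E.
  apply: ge0_nondecreasing_set_cvg_integral.
  - apply/nondecreasing_seqP => n; apply/subsetPset => x.
    rewrite /F/= !in_itv/= => /andP[nx ->]; rewrite andbT (le_trans _ nx)//.
    by rewrite lef_pV2 ?posrE// ler_nat.
  - by move=> n; exact: measurable_itv.
  - by move=> n; exact: measurable_funTS.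
  - by move=> n x _; rewrite lee_fin powR_ge0.
rewrite seq01 -(cvg_lim _ cvgI)//; apply: lime_le; first exact: cvgP cvgI.
apply: nearW => n.
have cp (x : R) : 0 < x -> {for x, continuous (fun y : R => a^-1 * y `^ a)}.
  move=> x0; apply: differentiable_continuous; apply/derivable1_diffP.
  by apply: derivableZ; apply: derivable_powR; rewrite in_itv/= x0.
rewrite (@continuous_FTC2 _ _ (fun x => a^-1 * x `^ a))//.
- rewrite powR1 mulr1 -EFinB lee_fin gerBl mulr_ge0 ?powR_ge0// invr_ge0 ltW//.
- apply: continuous_in_subspaceT => x; rewrite inE/= in_itv/= => /andP[nx _].
  have x0 : 0 < x by exact: lt_le_trans nx.
  apply: differentiable_continuous; apply/derivable1_diffP.
  by apply: derivable_powR; rewrite in_itv/= x0.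
- split.
  + move=> x; rewrite in_itv/= => /andP[nx _].
    apply: derivableZ; apply: derivable_powR; rewrite in_itv/= andbT.
    exact: lt_trans nx.
  + by apply: cvg_at_right_filter; exact: cp.
  + by apply: cvg_at_left_filter; exact: cp.
- move=> x; rewrite in_itv/= => /andP[nx _]; have x0 : 0 < x by exact: lt_trans nx.
  rewrite derive1E deriveZ/=; last by apply: derivable_powR; rewrite in_itv/= x0.
  have -> := @derive_val _ _ _ _ _ _ _ (is_derive1_powR a x0).
  by rewrite /GRing.scale/= mulrA mulVf ?gt_eqF// mul1r.
Qed.

Lemma integral_expRN (t : R) :
  (\int[mu]_(x in `[t, +oo[) (expR (- x))%:E = (expR (- t))%:E)%E.
Proof.
have dN (x : R) : is_derive x (1 : R) (fun x : R => - expR (- x)) (expR (- x)).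
  have := is_deriveN (is_derive1_comp (is_derive_expR (- x))
    (is_deriveN (is_derive_id x (1 : R)))).
  by rewrite mulrN1 opprK.
have cN : continuous (fun x : R => - expR (- x)).
  move=> x; apply: differentiable_continuous; apply/derivable1_diffP.
  exact: ex_derive.
rewrite (@ge0_continuous_FTC2y _ _ (fun x => - expR (- x)) _ 0).
- by rewrite sub0e EFinN oppeK.
- by move=> x _; exact: expR_ge0.
- apply: continuous_subspaceT => x; apply: continuous_comp; last exact: continuous_expR.
  exact: opp_continuous.
- by rewrite -oppr0; apply: cvgN; exact: cvgr_expR.
- by move=> x _; exact: ex_derive.
- by apply: cvg_at_right_filter; exact: cN.
- by move=> x _; rewrite derive1E; exact: derive_val.
Qed.

Definition gamma_weight (a x : R) : R := x `^ (a - 1) * expR (- x).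

Lemma measurable_gamma_weight a : measurable_fun setT (gamma_weight a).
Proof.
apply: measurable_funM; first exact: measurable_powR.
by apply: measurableT_comp => //; exact: measurableT_comp.
Qed.

Lemma gamma_weight_ge0 a x : 0 <= gamma_weight a x.
Proof. by rewrite mulr_ge0 ?powR_ge0 ?expR_ge0. Qed.

(** From [ln y <= y - 1] at [y = x / (2 a)]. *)
Let gamma_weight_tail (a x : R) : 0 < a -> 1 < x ->
  gamma_weight a x <= expR (a * ln (2 * a)) * expR (- (2^-1 * x)).
Proof.
move=> a0 x1; have x0 : 0 < x by exact: lt_trans x1.
rewrite /gamma_weight /powR gt_eqF// -!expRD ler_expR.
have lx : 0 <= ln x by rewrite ln_ge0// ltW.
have := @le_ln1Dx _ (x / (2 * a) - 1).
rewrite [1 + _]addrC subrK lnM ?posrE ?invr_gt0 ?mulr_gt0//.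
rewrite lnV ?posrE ?mulr_gt0// ltrBDl subrr divr_gt0 ?mulr_gt0// => /(_ isT) H.
have : a * (ln x - ln (2 * a)) <= a * (x / (2 * a) - 1) by rewrite ler_pM2l.
have -> : a * (x / (2 * a) - 1) = 2^-1 * x - a by field; rewrite gt_eqF.
by rewrite mulrBr mulrBl mul1r; lra.
Qed.

Lemma integral_gamma_weight_lty (a : R) : 0 < a ->
  (\int[mu]_(x in `]0%R, +oo[) (gamma_weight a x)%:E < +oo)%E.
Proof.
move=> a0.
have mg : measurable_fun setT (fun x => (gamma_weight a x)%:E).
  by apply/measurable_EFinP; exact: measurable_gamma_weight.
have -> : (`]0, +oo[%classic : set R) = `]0, 1] `|` `]1, +oo[.
  apply/seteqP; split => x /=; rewrite !in_itv/= ?andbT.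
    by move=> x0; have [x1|x1] := leP x 1; [left|right]; rewrite ?x0.
  by move=> [/andP[]//|]; exact: lt_trans.
rewrite ge0_integral_setU//=; last 3 first.
- exact: measurable_funTS.
- by move=> x _; rewrite lee_fin gamma_weight_ge0.
- apply/disj_setPS => x /= []; rewrite !in_itv/= andbT => /andP[_ x1].
  by rewrite ltNge x1.
apply: lte_add_pinfty.
  apply: (@le_lt_trans _ _ (a^-1)%:E); last exact: ltry.
  apply: le_trans (integral_powR01 a0); apply: ge0_le_integral => //.
  - by move=> x _; rewrite lee_fin gamma_weight_ge0.
  - exact: measurable_funTS.
  - by apply/measurable_EFinP; apply: measurable_funTS; exact: measurable_powR.
  - move=> x /=; rewrite in_itv/= => /andP[x0 _]; rewrite lee_fin.
    by rewrite ler_piMr ?powR_ge0// -expR0 ler_expR oppr_le0 ltW.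
pose C := expR (a * ln (2 * a)).
have mE (c : R) : measurable_fun setT (fun x : R => (expR (- (c * x)))%:E).
  apply/measurable_EFinP; apply: measurableT_comp => //.
  by apply: measurableT_comp => //; exact: mulrl_measurable.
have mE1 : measurable_fun setT (fun x : R => (expR (- x))%:E).
  by apply/measurable_EFinP; apply: measurableT_comp => //; exact: measurableT_comp.
have E1 : (\int[mu]_(x in `]0%R, +oo[) (expR (- x))%:E = 1)%E.
  by rewrite integral_itv_obnd_cbnd ?integral_expRN ?oppr0 ?expR0//; exact: measurable_funTS.
apply: (@le_lt_trans _ _ (C%:E * (2^-1^-1%:E * 1))%E); last first.
  by rewrite mule1 -EFinM ltry.
rewrite -E1 -ge0_integral_scale//.
rewrite -ge0_integralZl//; last 2 first.
- by apply: measurable_funTS; exact: mE.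
- by rewrite lee_fin expR_ge0.
apply: (@le_trans _ _ (\int[mu]_(x in `]1%R, +oo[) (C%:E * (expR (- (2^-1 * x)))%:E))%E).
  apply: ge0_le_integral => //.
  - by move=> x _; rewrite lee_fin gamma_weight_ge0.
  - exact: measurable_funTS.
  - by apply: measurable_funTS; apply: emeasurable_funM => //; exact: mE.
  - move=> x /=; rewrite in_itv/= andbT => x1; rewrite -EFinM lee_fin.
    exact: gamma_weight_tail.
apply: ge0_subset_integral => //.
- by apply: measurable_funTS; apply: emeasurable_funM => //; exact: mE.
- by move=> x _; rewrite -EFinM lee_fin mulr_ge0 ?expR_ge0.
- by move=> x /=; rewrite !in_itv/= !andbT; exact: lt_trans.
Qed.

Lemma gamma_funE (a : R) : 0 < a ->
  (\int[mu]_(x in `]0%R, +oo[) (gamma_weight a x)%:E = (gamma_fun a)%:E)%E.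
Proof.
move=> a0; rewrite /gamma_fun /Rintegral fineK// ge0_fin_numE.
  exact: integral_gamma_weight_lty.
by apply: integral_ge0 => x _; rewrite lee_fin gamma_weight_ge0.
Qed.

Lemma gamma_fun_gt0 (a : R) : 0 < a -> 0 < gamma_fun a.
Proof.
move=> a0; rewrite -lte_fin -gamma_funE//.
(* a lower bound of the integrand on [[1, 2]], where [0 <= ln x <= 1] *)
pose c := expR (- `|a - 1| - 2).
apply: (@lt_le_trans _ _ (\int[mu]_(x in `[1%R, 2%R]) c%:E)%E).
  rewrite integral_cst//= lebesgue_measure_itv/= lte_fin ltr1n -EFinB -EFinM lte_fin.
  by rewrite mulr_gt0 ?expR_gt0// subr_gt0 ltr1n.
apply: (@le_trans _ _ (\int[mu]_(x in `[1%R, 2%R]) (gamma_weight a x)%:E)%E).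
  apply: ge0_le_integral => //.
  - by move=> x _; rewrite lee_fin expR_ge0.
  - by apply/measurable_EFinP; apply: measurable_funTS; exact: measurable_gamma_weight.
  - move=> x /=; rewrite in_itv/= => /andP[x1 x2]; rewrite lee_fin.
    have x0 : 0 < x by exact: lt_le_trans x1.
    rewrite /gamma_weight /powR gt_eqF// -expRD ler_expR lerD ?lerN2//.
    rewrite lerNl -mulNr.
    apply: le_trans (ler_norm _) _; rewrite normrM normrN.
    rewrite ler_piMr// ger0_norm ?ln_ge0//.
    have := @le_ln1Dx _ (x - 1); rewrite [1 + _]addrC subrK => /(_ _); lra.
apply: ge0_subset_integral => //.
- by apply/measurable_EFinP; apply: measurable_funTS; exact: measurable_gamma_weight.
- by move=> x _; rewrite lee_fin gamma_weight_ge0.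
- by move=> x /=; rewrite !in_itv/= andbT => /andP[x1 _]; exact: lt_le_trans x1.
Qed.

End gamma_finite.

Section gamma_law.
Local Open Scope ereal_scope.
Context {R : realType}.
Notation mu := (@lebesgue_measure R).
Implicit Types (a b c : R) (F : R -> \bar R).

Lemma ge0_fubini_pos (G : R * R -> \bar R) :
  measurable_fun setT G -> (forall z, 0 <= G z) ->
  \int[mu]_(x in `]0%R, +oo[) \int[mu]_(t in `]0%R, +oo[) G (x, t) =
  \int[mu]_(t in `]0%R, +oo[) \int[mu]_(x in `]0%R, +oo[) G (x, t).
Proof.
move=> mG G0; pose P : set R := `]0%R, +oo[%classic.
pose f := G \_ (P `*` P).
have mP : measurable P by exact: measurable_itv.
have mf : measurable_fun [set: measurableTypeR R * measurableTypeR R] f.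
  apply/(measurable_restrictT _ _).1; first exact: measurableX.
  exact: measurable_funTS.
have f0 z : 0 <= f z by rewrite /f patchE; case: ifPn.
have fE (x t : R) : f (x, t) = if x \in P then (if t \in P then G (x, t) else 0) else 0.
  by rewrite /f patchE in_setX/=; case: (x \in P).
transitivity (\int[mu]_x \int[mu]_t f (x, t)).
  rewrite integral_mkcond; apply: eq_integral => x _; rewrite patchE.
  case: ifPn => xP.
    rewrite integral_mkcond; apply: eq_integral => t _.
    by rewrite fE xP patchE.
  by rewrite integral0_eq// => t _; rewrite fE (negbTE xP).
have := fubini_tonelli (m1 := mu) (m2 := mu) f mf f0.
rewrite /= => ->.
rewrite [RHS]integral_mkcond; apply: eq_integral => t _; rewrite patchE.
case: ifPn => tP.
  rewrite [RHS]integral_mkcond; apply: eq_integral => x _.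
  by rewrite fE patchE tP.
by rewrite integral0_eq// => x _; rewrite fE (negbTE tP) if_same.
Qed.

Lemma gamma_pdfE a x : gamma_pdf a x =
  (if x \in (`]0%R, +oo[%classic : set R) then gamma_weight a x / gamma_fun a else 0)%R.
Proof. by rewrite /gamma_pdf patchE. Qed.

Lemma measurable_gamma_pdf a : measurable_fun setT (gamma_pdf a).
Proof.
apply/(measurable_restrictT _ _).1 => //; apply: measurable_funTS.
by apply: measurable_funM => //; exact: measurable_gamma_weight.
Qed.

Lemma gamma_pdf_ge0 a x : (0 <= gamma_pdf a x)%R.
Proof.
rewrite gamma_pdfE; case: ifPn => // _; rewrite divr_ge0 ?gamma_weight_ge0//.
by apply: Rintegral_ge0 => y _; exact: gamma_weight_ge0.
Qed.

(** [gamma_prob] as a probability measure; [mnormalize] makes it one for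
    negative shapes as well. *)
Definition gamma_law a : probability (measurableTypeR R) R :=
  let d0 : probability (measurableTypeR R) R := dirac (0%R : measurableTypeR R) in
  if a == 0%R then d0
  else mnormalize (density mu (measurable_gamma_pdf a) (gamma_pdf_ge0 a)) d0.

Lemma gamma_pdf_int a F (mF : measurable_fun setT F) (F0 : forall x, 0 <= F x) :
  (0 < a)%R ->
  \int[mu]_x (F x * (gamma_pdf a x)%:E) =
  (gamma_fun a)^-1%:E * \int[mu]_(x in `]0%R, +oo[) (F x * (gamma_weight a x)%:E).
Proof.
move=> a0; rewrite -ge0_integralZl//; last 3 first.
- apply: measurable_funTS; apply: emeasurable_funM => //.
  by apply/measurable_EFinP; exact: measurable_gamma_weight.
- by move=> x _; rewrite mule_ge0// lee_fin gamma_weight_ge0.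
- by rewrite lee_fin invr_ge0 ltW// gamma_fun_gt0.
rewrite [RHS]integral_mkcond; apply: eq_integral => x _.
rewrite patchE gamma_pdfE; case: ifPn => _; last by rewrite mule0.
by rewrite muleCA -EFinM mulrC.
Qed.

Lemma gamma_pdf_mass a : (0 < a)%R -> \int[mu]_x (gamma_pdf a x)%:E = 1.
Proof.
move=> a0; have := gamma_pdf_int (F := cst 1) (measurable_cst _) (fun=> lee01) a0.
under eq_integral do rewrite mul1e.
move=> ->; under eq_integral do rewrite mul1e.
by rewrite gamma_funE// -EFinM mulVf// gt_eqF// gamma_fun_gt0.
Qed.

Lemma gamma_lawE a A : (0 <= a)%R -> measurable A -> gamma_law a A = gamma_prob a A.
Proof.
rewrite /gamma_law /gamma_prob le_eqVlt eq_sym => /predU1P[->|a0] mA.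
  by rewrite eqxx.
have dE := @mnormalize1E _ _ _
  (density mu (measurable_gamma_pdf a) (gamma_pdf_ge0 a))
  (dirac (0%R : measurableTypeR R)) A (gamma_pdf_mass a0).
rewrite gt_eqF//; exact: dE.
Qed.

Lemma ge0_integral_gamma0 F : measurable_fun setT F -> (forall x, 0 <= F x) ->
  \int[gamma_law 0]_x F x = F 0%R.
Proof.
move=> mF F0; rewrite /gamma_law eqxx.
by rewrite (integral_dirac _ measurableT)// diracT mul1e.
Qed.

Lemma ge0_integral_gamma a F : measurable_fun setT F -> (forall x, 0 <= F x) ->
  (0 < a)%R -> \int[gamma_law a]_x F x =
  (gamma_fun a)^-1%:E * \int[mu]_(x in `]0%R, +oo[) (F x * (gamma_weight a x)%:E).
Proof.
move=> mF F0 a0; rewrite -gamma_pdf_int//.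
apply: (@ge0_integral_dominated _ (measurableTypeR R) R mu (gamma_law a) _ setT F
  (measurable_gamma_pdf a) (gamma_pdf_ge0 a)) => //.
move=> A mA; apply: (etrans (gamma_lawE (ltW a0) mA)).
by rewrite /gamma_prob gt_eqF.
Qed.

Lemma gamma_mgf a c : (0 <= a)%R -> (c < 1)%R ->
  \int[gamma_law a]_x (expR (c * x))%:E = ((1 - c) `^ (- a))%:E.
Proof.
move=> a0 c1; have mE : measurable_fun setT (fun x : R => (expR (c * x))%:E).
  by apply/measurable_EFinP; apply: measurableT_comp => //; exact: mulrl_measurable.
have E0 x : 0 <= (expR (c * x))%:E by rewrite lee_fin expR_ge0.
move: a0; rewrite le_eqVlt => /predU1P[<-|a0].
  by rewrite ge0_integral_gamma0// mulr0 expR0 oppr0 powRr0.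
rewrite ge0_integral_gamma//; set k := (1 - c)%R.
have k0 : (0 < k)%R by rewrite subr_gt0.
have kD p q : (k `^ p * k `^ q = k `^ (p + q))%R.
  by rewrite powRD// (gt_eqF k0) implybT.
pose W (x : R) := (gamma_weight a (k * x))%:E.
have mW : measurable_fun setT W.
  apply/measurable_EFinP; apply: measurableT_comp; last exact: mulrl_measurable.
  exact: measurable_gamma_weight.
have W0 x : 0 <= W x by rewrite lee_fin gamma_weight_ge0.
pose I := (k `^ (1 - a))%:E * \int[mu]_(x in `]0%R, +oo[) W x.
transitivity ((gamma_fun a)^-1%:E * I).
  congr (_ * _); rewrite /I -ge0_integralZl.
  - apply: eq_integral => x; rewrite inE/= in_itv/= andbT => x0.
    rewrite /W -!EFinM; congr EFin; rewrite /gamma_weight powRM ?ltW//.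
    rewrite mulrCA -expRD 2!mulrA kD addrA subrK subrr powRr0 mul1r.
    by congr (_ * expR _)%R; rewrite /k; ring.
  - exact: measurable_itv.
  - exact: measurable_funTS.
  - by move=> x _; exact: W0.
  - by rewrite lee_fin powR_ge0.
rewrite /I (ge0_integral_scale (F := fun x => (gamma_weight a x)%:E))//; last 2 first.
- by apply/measurable_EFinP; exact: measurable_gamma_weight.
- by move=> x; rewrite lee_fin gamma_weight_ge0.
rewrite gamma_funE// -!EFinM; congr EFin.
rewrite -(powR_inv1 (ltW k0)) [(k `^ (1 - a) * _)%R]mulrA kD.
rewrite mulrCA mulVf ?mulr1 ?gt_eqF ?gamma_fun_gt0//.
by congr (_ `^ _)%R; ring.
Qed.

Lemma measurable_gamma_shift b F : measurable_fun setT F ->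
  (forall x, 0 <= F x) ->
  measurable_fun setT (fun x : R => \int[gamma_law b]_y F (x + y)%R).
Proof.
move=> mF F0; pose f2 (z : R * R) := F (z.1 + z.2)%R.
apply: (measurable_fun_fubini_tonelli_F (m2 := gamma_law b) f2).
  by apply: measurableT_comp => //; exact: measurable_funD.
by move=> z; exact: F0.
Qed.

(** The Jacobian of [y = x t] is the factor [x]; the right-hand side separates
    [t] from [s = x (1 + t)]. *)
Lemma gamma_weight_polar a b (x t : R) : (0 < x)%R -> (0 < t)%R ->
  (x * gamma_weight a x * gamma_weight b (x * t) =
   gamma_weight (a + b) ((1 + t) * x) * (t `^ (b - 1) * (1 + t) `^ (1 - (a + b))))%R.
Proof.
move=> x0 t0; have t1 : (0 < 1 + t)%R by rewrite addr_gt0.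
have xD p q : (x `^ p * x `^ q = x `^ (p + q))%R.
  by rewrite powRD// (gt_eqF x0) implybT.
have tD p q : ((1 + t) `^ p * (1 + t) `^ q = (1 + t) `^ (p + q))%R.
  by rewrite powRD// (gt_eqF t1) implybT.
rewrite /gamma_weight !powRM ?ltW// -{1}(powRr1 (ltW x0)).
transitivity ((x `^ 1 * x `^ (a - 1) * x `^ (b - 1)) * t `^ (b - 1) *
  (expR (- x) * expR (- (x * t))))%R; first by ring.
transitivity (((1 + t) `^ (a + b - 1) * (1 + t) `^ (1 - (a + b))) *
  x `^ (a + b - 1) * t `^ (b - 1) * expR (- ((1 + t) * x)))%R; last by ring.
rewrite !xD tD -expRD [X in ((1 + t) `^ X)%R](_ : _ = 0%R); last by ring.
rewrite powRr0 mul1r; congr (_ `^ _ * _ * expR _)%R; ring.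
Qed.

(** Convolution: with [y = x t] and then [s = x (1 + t)] the double integral
    factors into an integral over [t], which does not depend on [F], times the
    integral against the law of shape [a + b]; taking [F = 1] identifies the
    factor. *)
Let gamma_conv_pos a b : (0 < a)%R -> (0 < b)%R ->
  exists K : \bar R, forall F, measurable_fun setT F -> (forall x, 0 <= F x) ->
  \int[gamma_law a]_x \int[gamma_law b]_y F (x + y)%R =
  K * \int[gamma_law (a + b)]_s F s.
Proof.
move=> a0 b0; have ab0 : (0 < a + b)%R by rewrite addr_gt0.
have mP : measurable (`]0%R, +oo[%classic : set (measurableTypeR R)).
  exact: measurable_itv.
pose k t := (t `^ (b - 1) * (1 + t) `^ (1 - (a + b)))%R.
have k0 t : (0 <= k t)%R by rewrite mulr_ge0 ?powR_ge0.
have mS p : measurable_fun setT (fun t : R => (1 + t) `^ p)%R.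
  apply: (@measurableT_comp _ _ _ _ _ _ (@powR R ^~ p)).
    exact: measurable_powR.
  exact: measurable_funD.
have mk : measurable_fun setT k.
  by apply: measurable_funM; [exact: measurable_powR|exact: mS].
pose Ga := (gamma_fun a)^-1%:E; pose Gb := (gamma_fun b)^-1%:E.
have Ga0 : 0 <= Ga by rewrite lee_fin invr_ge0 ltW// gamma_fun_gt0.
have Gb0 : 0 <= Gb by rewrite lee_fin invr_ge0 ltW// gamma_fun_gt0.
pose k' t := Gb * (k t)%:E * ((1 + t) `^ (-1))%:E.
exists (Ga * (\int[mu]_(t in `]0%R, +oo[) k' t * (gamma_fun (a + b))%:E)).
move=> F mF F0.
have mw c : measurable_fun setT (fun x => (gamma_weight c x)%:E).
  by apply/measurable_EFinP; exact: measurable_gamma_weight.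
have w0 c x : 0 <= (gamma_weight c x)%:E by rewrite lee_fin gamma_weight_ge0.
pose H s := F s * (gamma_weight (a + b) s)%:E.
have mH : measurable_fun setT H by exact: emeasurable_funM.
have H0 s : 0 <= H s by rewrite mule_ge0.
pose G (z : R * R) := Gb * (k z.2)%:E * H ((1 + z.2) * z.1)%R.
have mG : measurable_fun setT G.
  apply: emeasurable_funM; last first.
    apply: measurableT_comp => //; apply: measurable_funM => //.
    exact: measurable_funD.
  apply: measurable_funeM; apply/measurable_EFinP.
  by apply: (@measurableT_comp _ _ _ _ _ _ k).
have Gbk0 t : 0 <= Gb * (k t)%:E by apply: mule_ge0 => //; rewrite lee_fin.
have G0 z : 0 <= G z by apply: mule_ge0; [exact: Gbk0|exact: H0].
have mFx (x : R) : measurable_fun setT (fun y : R => F (x + y)%R).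
  by apply: measurableT_comp => //; exact: measurable_funD.
pose Phi x := \int[gamma_law b]_y F (x + y)%R.
have mPhi : measurable_fun setT Phi.
  exact: measurable_gamma_shift.
have Phi0 x : 0 <= Phi x by apply: integral_ge0.
apply: (etrans (ge0_integral_gamma mPhi Phi0 a0)).
rewrite -muleA; congr (_ * _).
transitivity (\int[mu]_(x in `]0%R, +oo[) \int[mu]_(t in `]0%R, +oo[) G (x, t)).
  apply: eq_integral => x; rewrite inE/= in_itv/= andbT => x0.
  pose E y := F (x + y)%R * (gamma_weight b y)%:E.
  have mE : measurable_fun setT E by exact: emeasurable_funM.
  have E0 y : 0 <= E y by rewrite mule_ge0.
  have c0 : 0 <= Gb * (x * gamma_weight a x)%:E.
    by rewrite mule_ge0// lee_fin mulr_ge0 ?gamma_weight_ge0 ?ltW.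
  transitivity (Gb * (x * gamma_weight a x)%:E *
      \int[mu]_(t in `]0%R, +oo[) E (x * t)%R).
    rewrite ge0_integral_scale//.
    have -> : Phi x = Gb * \int[mu]_(y in `]0%R, +oo[) E y.
      exact: ge0_integral_gamma (mFx x) (fun y => F0 _) b0.
    rewrite -!muleA; congr (_ * _).
    by rewrite muleC muleA -EFinM mulrAC divff ?mul1r ?gt_eqF.
  rewrite -(ge0_integralZl _ mP).
  - apply: eq_integral => t; rewrite inE/= in_itv/= andbT => t0.
    rewrite /G /E /H/= -!muleA; congr (_ * _).
    rewrite (_ : x + x * t = (1 + t) * x)%R; last by ring.
    rewrite muleCA [RHS]muleCA; congr (_ * _).
    by rewrite -!EFinM [X in _ = X%:E]mulrC -gamma_weight_polar.
  - apply: measurable_funTS; apply: measurableT_comp => //.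
  - by move=> t _; exact: E0.
  - exact: c0.
rewrite ge0_fubini_pos//.
pose IH := \int[mu]_(s in `]0%R, +oo[) H s.
have IH0 : 0 <= IH by apply: integral_ge0.
have k'0 t : (0 < t)%R -> 0 <= k' t.
  move=> t0; apply: mule_ge0; first exact: Gbk0.
  by rewrite lee_fin powR_ge0.
transitivity (\int[mu]_(t in `]0%R, +oo[) (k' t * IH)).
  apply: eq_integral => t; rewrite inE/= in_itv/= andbT => t0.
  have t1 : (0 < 1 + t)%R by rewrite addr_gt0.
  rewrite /k' powR_inv1 ?ltW// -muleA -ge0_integral_scale//.
  rewrite -(ge0_integralZl _ mP).
  - by [].
  - apply: measurable_funTS; apply: measurableT_comp => //.
  - by move=> x _; exact: H0.
  - exact: Gbk0.
rewrite ge0_integralZr//; last 2 first.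
- apply: emeasurable_funM.
    by apply: measurable_funeM; apply/measurable_EFinP; exact: measurable_funTS.
  by apply/measurable_EFinP; apply: measurable_funTS; exact: mS.
- by move=> t /=; rewrite in_itv/= andbT; exact: k'0.
rewrite -[RHS]muleA; congr (_ * _).
have -> : \int[gamma_law (a + b)]_s F s = (gamma_fun (a + b))^-1%:E * IH.
  exact: ge0_integral_gamma mF F0 ab0.
by rewrite muleA -EFinM divff ?mul1e// gt_eqF// gamma_fun_gt0.
Qed.

Lemma gamma_conv a b F : (0 <= a)%R -> (0 <= b)%R ->
  measurable_fun setT F -> (forall x, 0 <= F x) ->
  \int[gamma_law a]_x \int[gamma_law b]_y F (x + y)%R =
  \int[gamma_law (a + b)]_s F s.
Proof.
move=> + + mF F0.
have mFx (x : R) : measurable_fun setT (fun y : R => F (x + y)%R).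
  by apply: measurableT_comp => //; exact: measurable_funD.
rewrite le_eqVlt => /predU1P[<- b0|a0].
  have Phi0 (x : R) : 0 <= \int[gamma_law b]_y F (x + y)%R.
    by apply: integral_ge0.
  rewrite add0r.
  apply: (etrans (ge0_integral_gamma0 (measurable_gamma_shift b mF F0) Phi0)).
  by apply: eq_integral => y _; rewrite add0r.
rewrite le_eqVlt => /predU1P[<-|b0].
  rewrite addr0; apply: eq_integral => x _.
  by rewrite (ge0_integral_gamma0 (mFx x) (fun y => F0 _)) addr0.
have [K KE] := gamma_conv_pos a0 b0.
have e1 c : \int[gamma_law c]_s cst 1 s = 1 := integral_cst_probability _ 1.
have K1 : 1 = K * \int[gamma_law (a + b)]_s cst 1 s.
  apply: (etrans _ (KE (cst 1) (measurable_cst _) (fun=> lee01))).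
  apply/esym; apply: (@etrans _ _ (\int[gamma_law a]_x cst 1 x)); last exact: e1.
  by apply: eq_integral => x _; exact: e1.
apply: (etrans (KE F mF F0)); rewrite e1 mule1 in K1.
by rewrite -K1 mul1e.
Qed.

End gamma_law.

(** * Tails of weighted sums of gamma variables *)

Section gamma_tail.
Local Open Scope ereal_scope.
Context {R : realType}.
Notation mu := (@lebesgue_measure R).
Implicit Types (a b c w y : R) (F : R -> \bar R).

(** Gamma laws live on the nonnegative half-line, so a comparison there is
    enough. *)
Lemma gamma_le_integral c F G : (0 <= c)%R ->
  measurable_fun setT F -> (forall x, 0 <= F x) ->
  measurable_fun setT G -> (forall x, 0 <= G x) ->
  (forall x, (0 <= x)%R -> F x <= G x) ->
  \int[gamma_law c]_x F x <= \int[gamma_law c]_x G x.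
Proof.
move=> + mF F0 mG G0 FG; rewrite le_eqVlt => /predU1P[<-|c0].
  rewrite (ge0_integral_gamma0 mF F0) (ge0_integral_gamma0 mG G0).
  exact: FG.
rewrite (ge0_integral_gamma mF F0 c0) (ge0_integral_gamma mG G0 c0).
have mw : measurable_fun setT (fun x => (gamma_weight c x)%:E).
  by apply/measurable_EFinP; exact: measurable_gamma_weight.
have w0 x : 0 <= (gamma_weight c x)%:E by rewrite lee_fin gamma_weight_ge0.
apply: lee_wpmul2l; first by rewrite lee_fin invr_ge0 ltW// gamma_fun_gt0.
apply: ge0_le_integral.
- exact: measurable_itv.
- by move=> x _; apply: mule_ge0.
- by apply: measurable_funTS; exact: emeasurable_funM.
- by apply: measurable_funTS; exact: emeasurable_funM.
- move=> x /=; rewrite in_itv/= andbT => x0; apply: lee_wpmul2r => //.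
  exact/FG/ltW.
Qed.

Definition step w : \bar R := ((0 <= w)%R%:R : R)%:E.

Lemma step_ge0 w : 0 <= step w.
Proof. by rewrite lee_fin ler0n. Qed.

Lemma step_le1 w : step w <= 1.
Proof. by rewrite lee_fin lern1 leq_b1. Qed.

Lemma le_step w w' : (w <= w')%R -> step w <= step w'.
Proof.
move=> ww'; rewrite lee_fin ler_nat; case: (leP 0%R w) => // w0.
by rewrite (le_trans w0 ww').
Qed.

Lemma measurable_step : measurable_fun setT step.
Proof.
apply/measurable_EFinP.
rewrite (_ : (fun w => _) = \1_(`[0%R, +oo[%classic)).
  exact: measurable_indic.
apply/funext => w; rewrite indicE mem_setE in_itv/= andbT.
by [].
Qed.

(** [tail cells w] is the probability that [w + \sum_i Z_i y_i >= 0] for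
    independent [Z_i] of law Gamma(a_i, 1), where [cells] lists the pairs
    [(a_i, y_i)], written as an iterated integral. *)
Fixpoint tail (cells : seq (R * R)) w : \bar R :=
  if cells is (a, y) :: cells' then \int[gamma_law a]_z tail cells' (w + z * y)%R
  else step w.

Lemma tail_ge0 cells w : 0 <= tail cells w.
Proof.
by elim: cells w => [|[a y] cells IH] w /=; [exact: step_ge0|exact: integral_ge0].
Qed.

Lemma measurable_tail cells : measurable_fun setT (tail cells).
Proof.
elim: cells => [|[a y] cells IH]; first exact: measurable_step.
pose f2 (z : R * R) := tail cells (z.1 + z.2 * y)%R.
apply: (measurable_fun_fubini_tonelli_F (m2 := gamma_law a) f2).
  apply: measurableT_comp => //; apply: measurable_funD => //.
  exact: measurable_funM.
by move=> z; exact: tail_ge0.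
Qed.

Lemma measurable_tail_comp cells w y :
  measurable_fun setT (fun z : R => tail cells (w + z * y)%R).
Proof.
apply: measurableT_comp; first exact: measurable_tail.
by apply: measurable_funD => //; exact: measurable_funM.
Qed.

Lemma measurable_exp_affine c w :
  measurable_fun setT (fun s : R => (expR (w + c * s))%:E).
Proof.
apply/measurable_EFinP; apply: measurableT_comp => //.
by apply: measurable_funD => //; exact: mulrl_measurable.
Qed.

Lemma integral_exp_gamma a c w : (0 <= a)%R -> (c < 1)%R ->
  \int[gamma_law a]_z (expR (w + c * z))%:E = (expR w * (1 - c) `^ (- a))%:E.
Proof.
move=> a0 c1; have mE : measurable_fun setT (fun z : R => (expR (c * z))%:E).
  by apply/measurable_EFinP; apply: measurableT_comp => //; exact: mulrl_measurable.
transitivity (\int[gamma_law a]_z ((expR w)%:E * (expR (c * z))%:E)).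
  by apply: eq_integral => z _; rewrite -EFinM expRD.
have E0 z : [set: R] z -> 0 <= (expR (c * z))%:E by rewrite lee_fin expR_ge0.
have k0 : 0 <= (expR w)%:E by rewrite lee_fin expR_ge0.
apply: (etrans (ge0_integralZl (gamma_law a) measurableT mE E0 k0)).
by rewrite gamma_mgf// EFinM.
Qed.

(** The exponential tail: [P(v + E Y >= 0) = min(1, e^(v / Y))] for [E] of law
    Gamma(1, 1), and [min(1, e^(v / Y)) <= e^(l v)] for [0 <= l <= 1 / Y]. *)
Lemma tail_exp1 l Y v : (0 <= l)%R -> (0 < Y)%R -> (l * Y <= 1)%R ->
  tail [:: (1%R, Y)] v <= (expR (l * v))%:E.
Proof.
move=> l0 Y0 lY /=.
have mS : measurable_fun setT (fun s : R => step (v + s * Y)%R).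
  exact: (measurable_tail_comp [::]).
have [v0|v0] := leP 0%R v.
  apply: (@le_trans _ _ 1).
    rewrite -(integral_cst_probability (gamma_law 1) 1).
    apply: ge0_le_integral => //.
    - by move=> s _; exact: step_ge0.
    - by move=> s _; exact: step_le1.
  by rewrite lee_fin -expR0 ler_expR mulr_ge0.
have g1 x : (0 < x)%R -> gamma_weight 1 x = expR (- x).
  by move=> x0; rewrite /gamma_weight subrr powRr0 mul1r.
have mE1 : measurable_fun setT (fun x : R => (expR (- x))%:E).
  by apply/measurable_EFinP; apply: measurableT_comp => //; exact: measurableT_comp.
have G1 : gamma_fun (1 : R) = 1%R.
  apply: EFin_inj; rewrite -gamma_funE//.
  transitivity (\int[mu]_(x in `]0%R, +oo[) (expR (- x))%:E).
    by apply: eq_integral => x; rewrite inE/= in_itv/= andbT => x0; rewrite g1.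
  rewrite integral_itv_obnd_cbnd; first by rewrite integral_expRN oppr0 expR0.
  exact: measurable_funTS.
rewrite (ge0_integral_gamma mS (fun s => step_ge0 _) ltr01) G1 invr1 mul1e.
have t0 : (0 < - v / Y)%R by rewrite divr_gt0// oppr_gt0.
apply: (@le_trans _ _ (\int[mu]_(x in `[(- v / Y)%R, +oo[) (expR (- x))%:E)).
  rewrite integral_mkcond [leRHS]integral_mkcond le_eqVlt; apply/orP; left.
  apply/eqP; apply: eq_integral => x _; rewrite !patchE !mem_setE !in_itv/= !andbT.
  rewrite ler_pdivrMr//; case: ifPn => x0; last first.
    rewrite ifF//; apply/negP => vx; move: x0; apply/negP; rewrite negbK.
    by rewrite -(pmulr_lgt0 _ Y0) (lt_le_trans _ vx)// oppr_gt0.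
  rewrite g1// /step -lerBlDl sub0r; case: ifPn => _ /=; first by rewrite mul1e.
  by rewrite mul0e.
rewrite integral_expRN lee_fin ler_expR mulNr opprK.
by rewrite ler_pdivrMr// mulrAC ler_niMl// ltW.
Qed.

(** The two top cells: the mass [1 - b] missing from the cell of weight [Y] is
    split off the cell of weight [y] by convolution and moved up to [Y], where
    it completes the shape to [1]. *)
Lemma tail_top l b a Y y w : (0 <= l)%R -> (l * Y < 1)%R -> (0 < Y)%R ->
  (0 <= b <= 1)%R -> (0 <= a)%R -> (0 <= y <= Y)%R ->
  (y = 0 \/ 1 - b <= a)%R ->
  tail [:: (a, y); (b, Y)] w <=
  (expR (l * w) * (1 - l * y) `^ (- (a - (1 - b))))%:E.
Proof.
move=> l0 lY Y0 /andP[b0 b1] a0 /andP[y0 yY] cases.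
pose c := (1 - b)%R; have c0 : (0 <= c)%R by rewrite subr_ge0.
have cb1 : (c + b = 1)%R by rewrite subrK.
pose cellb := [:: (b, Y)].
(* moving the mass [c] from weight [y] up to [Y] can only increase the tail *)
have conv1 v : (\int[gamma_law c]_s tail cellb (v + s * y)%R <= (expR (l * v))%:E).
  apply: le_trans (tail_exp1 v l0 Y0 (ltW lY)).
  apply: (@le_trans _ _ (\int[gamma_law c]_s tail cellb (v + s * Y)%R)).
    apply: gamma_le_integral => //.
    - exact: measurable_tail_comp.
    - by move=> s; exact: tail_ge0.
    - exact: measurable_tail_comp.
    - by move=> s; exact: tail_ge0.
    - move=> s s0; apply: ge0_le_integral => //.
      + by move=> u _; exact: step_ge0.
      + exact: (measurable_tail_comp [::]).
      + exact: (measurable_tail_comp [::]).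
      + by move=> u _; apply: le_step; rewrite lerD2r lerD2l ler_wpM2l.
  rewrite -cb1 [leRHS]/=.
  have mS : measurable_fun setT (fun s : R => step (v + s * Y)%R).
    exact: (measurable_tail_comp [::]).
  rewrite le_eqVlt; apply/orP; left; apply/eqP.
  apply: (etrans _ (gamma_conv c0 b0 mS (fun=> step_ge0 _))).
  apply: eq_integral => s _ /=.
  by apply: eq_integral => u _; rewrite mulrDl addrA.
case: cases => [y_eq0|ca].
  have cst1 a' : \int[gamma_law a']_s tail cellb (w + s * y)%R = tail cellb w.
    transitivity (\int[gamma_law a']_s cst (tail cellb w) s).
      by apply: eq_integral => s _; rewrite y_eq0 mulr0 addr0.
    rewrite (integral_cst _ measurableT) -[RHS]mule1.
    by congr (_ * _); exact: probability_setT.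
  rewrite [leLHS](cst1 a) -(cst1 c) (le_trans (conv1 w))//.
  by rewrite y_eq0 mulr0 subr0 powR1 mulr1.
pose e := (a - c)%R; have e0 : (0 <= e)%R by rewrite subr_ge0.
have ec : (e + c = a)%R by rewrite subrK.
rewrite -/c -/e.
pose Psi s := tail cellb (w + s * y)%R.
have mPsi : measurable_fun setT Psi by exact: measurable_tail_comp.
have Psi0 s : 0 <= Psi s by exact: tail_ge0.
have conv_a := gamma_conv e0 c0 mPsi Psi0; rewrite ec in conv_a.
rewrite [leLHS](esym conv_a) {conv_a}.
apply: (@le_trans _ _ (\int[gamma_law e]_s (expR (l * w + (l * y) * s))%:E)).
  have mPhi := measurable_gamma_shift c mPsi Psi0.
  have Phi0 (s : R) : [set: R] s -> 0 <= \int[gamma_law c]_y Psi (s + y)%R.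
    by move=> _; apply: integral_ge0 => v _; exact: Psi0.
  have mE := measurable_exp_affine (l * y) (l * w).
  apply: (@ge0_le_integral _ _ _ (gamma_law e) _ measurableT _ _ Phi0 mPhi mE) => s _.
  rewrite -mulrA -mulrDr [(y * s)%R]mulrC.
  apply: le_trans (conv1 _); rewrite le_eqVlt; apply/orP; left; apply/eqP.
  by apply: eq_integral => u _; rewrite /Psi mulrDl addrA.
rewrite integral_exp_gamma//.
by rewrite (le_lt_trans _ lY)// ler_wpM2l.
Qed.

(** The remaining cells are integrated out one by one, each contributing its
    moment generating function as in the Chernoff bound. *)
Lemma tail_cells l b a Y y (cells : seq (R * R)) w :
  (0 <= l)%R -> (l * Y < 1)%R -> (0 < Y)%R ->
  (0 <= b <= 1)%R -> (0 <= a)%R -> (0 <= y <= Y)%R ->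
  (y = 0 \/ 1 - b <= a)%R ->
  {in cells, forall p, 0 <= p.1 /\ p.2 <= Y}%R ->
  tail (cells ++ [:: (a, y); (b, Y)]) w <=
  (expR (l * w) * (\prod_(p <- cells) (1 - l * p.2) `^ (- p.1) *
     (1 - l * y) `^ (- (a - (1 - b)))))%:E.
Proof.
move=> l0 lY Y0 b01 a0 yY cases; elim: cells w => [|[a' y'] cells IH] w hc.
  by rewrite big_nil mul1r; exact: tail_top.
have [a'0 y'Y] := hc (a', y') (mem_head _ _).
have {}IH w' := IH w' (fun p pc => hc p (mem_behead (s := _ :: _) pc)).
rewrite big_cons /=.
set C := (_ * (1 - l * y) `^ _)%R in IH *.
have C0 : (0 <= C)%R.
  by rewrite mulr_ge0 ?powR_ge0// prodr_ge0// => p _; exact: powR_ge0.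
have mE := measurable_exp_affine (l * y') (l * w).
have E0 s : [set: R] s -> 0 <= (expR (l * w + (l * y') * s))%:E by rewrite lee_fin expR_ge0.
apply: (@le_trans _ _ (\int[gamma_law a']_s (C%:E * (expR (l * w + (l * y') * s))%:E))).
  apply: (@ge0_le_integral _ _ _ (gamma_law a') _ measurableT _ _ (fun s _ => tail_ge0 _ _)
    (measurable_tail_comp _ _ _) (measurable_funeM C%:E mE)) => s _.
  apply: le_trans (IH _) _.
  rewrite -EFinM lee_fin mulrC ler_wpM2l// ler_expR.
  by rewrite mulrDr mulrA mulrAC.
have C0' : 0 <= C%:E by rewrite lee_fin.
rewrite (ge0_integralZl (gamma_law a') measurableT mE E0 C0').
rewrite integral_exp_gamma//; last by rewrite (le_lt_trans _ lY)// ler_wpM2l.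
rewrite -EFinM lee_fin /C.
by rewrite le_eqVlt; apply/orP; left; apply/eqP; ring.
Qed.

End gamma_tail.

(** * From Dirichlet laws to gamma variables *)

Section tuple_law.
Context d (T : measurableType d) (R : realType).

Definition box n (A : 'I_n -> set T) : set (n.-tuple T) :=
  [set y | forall i, A i (tnth y i)].

Lemma measurable_box n (A : 'I_n -> set T) :
  (forall i, measurable (A i)) -> measurable (box A).
Proof.
move=> mA.
rewrite (_ : box A = \bigcap_(i in [set: 'I_n]) ((@tnth n T)^~ i @^-1` A i)).
  apply: fin_bigcap_measurable => // i _.
  by rewrite -[X in measurable X]setTI; exact: measurable_tnth.
by apply/seteqP; split => [y yA i _|y yA i]; [exact: yA|exact: yA].
Qed.

(** Boxes are stable under intersection and generate the measurable sets. *)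
Lemma eq_tuple_law n (P Q : probability (n.-tuple T) R) :
  (forall A : 'I_n -> set T, (forall i, measurable (A i)) ->
    P (box A) = Q (box A)) ->
  forall E, measurable E -> P E = Q E.
Proof.
move=> PQ.
pose G := [set E | exists2 A : 'I_n -> set T, (forall i, measurable (A i)) & E = box A].
have GT : G setT.
  exists (fun=> setT) => //; by apply/seteqP; split.
apply: (measure_unique G (fun=> setT)).
- apply/seteqP; split.
    apply: smallest_sub; first exact: smallest_sigma_algebra.
    move=> E; rewrite -bigcup_seq => -[i /= _ [B mB <-]].
    apply: sub_sigma_algebra; exists (fun j => if j == i then B else setT).
      by move=> j; case: ifPn.
    rewrite setTI; apply/seteqP; split => [y /= yB j|y /(_ i)/=].
      by case: eqP => // ->.
    by rewrite eqxx.
  apply: smallest_sub; first exact: sigma_algebra_measurable.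
  by move=> _ [A mA ->]; exact: measurable_box.
- move=> _ _ [A mA ->] [B mB ->]; exists (fun i => A i `&` B i).
    by move=> i; exact: measurableI.
  apply/seteqP; split => [y [yA yB] i|y yAB]; first by split.
  by split=> i; have [] := yAB i.
- by [].
- by rewrite bigcup_const//; exists 0%N.
- by move=> _ [A mA ->]; exact: PQ.
- by move=> _; rewrite ltey_eq fin_num_measure.
Qed.

End tuple_law.

Section gamma_product.
Context {R : realType}.

Lemma measurable_halfspace n (c : 'I_n -> R) (w : R) :
  measurable [set y : n.-tuple R | 0 <= w + \sum_(i < n) tnth y i * c i].
Proof.
rewrite -[X in measurable X]setTI; apply: (measurable_fun_ler (f := cst 0)) => //.
apply: measurable_funD => //; apply: measurable_sum => i.
by apply: measurable_funM => //; exact: measurable_tnth.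
Qed.

Lemma is_product_law_behead n (P_ : 'I_n.+1 -> set R -> \bar R)
    (Q : probability (n.+1.-tuple R) R) : P_ ord0 setT = 1%E ->
  is_product_law P_ Q ->
  exists2 Q' : probability (n.-tuple R) R,
    is_product_law (fun i => P_ (lift ord0 i)) Q' &
    forall A : 'I_n.+1 -> set R, (forall i, measurable (A i)) ->
      Q (box A) = (P_ ord0 (A ord0) * Q' (box (fun i => A (lift ord0 i))))%E.
Proof.
move=> P1 QE.
pose m := image_measure Q (@measurable_behead _ R n).
have mT : m setT = 1%E by exact: probability_setT.
pose d0 : probability (n.-tuple R) R := dirac (nseq_tuple n (0 : R)).
pose Q' : probability (n.-tuple R) R := mnormalize m d0.
have Q'E A : Q' A = m A by exact: mnormalize1E.
have law' : is_product_law (fun i => P_ (lift ord0 i)) Q'.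
  move=> A mA; rewrite Q'E.
  pose A' i := if unlift ord0 i is Some j then A j else setT.
  transitivity (Q (box A')).
    rewrite /m /= /pushforward; congr (Q _); apply/seteqP; split => y yA i.
      rewrite /A'; case: unliftP => [j ->|//].
      by rewrite [y]tuple_eta tnthS; exact: yA.
    have := yA (lift ord0 i); rewrite /A' liftK.
    by rewrite [y in tnth y (lift _ _)]tuple_eta tnthS.
  rewrite QE; last by move=> i; rewrite /A'; case: unliftP.
  rewrite big_ord_recl /A' unlift_none P1 mul1e.
  by apply: eq_bigr => i _; rewrite liftK.
exists Q' => // A mA; rewrite QE// big_ord_recl; congr (_ * _)%E.
by rewrite law'.
Qed.

(** Induction on [n]: [Q] is the image under [cons] of the product of its first
    marginal with a product law, because they agree on boxes; Fubini then
    integrates the first coordinate last. *)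
Lemma gamma_product_tail n (a c : 'I_n -> R) (Q : probability (n.-tuple R) R) w :
  (forall i, 0 <= a i) -> is_product_law (fun i => gamma_prob (a i)) Q ->
  Q [set y | 0 <= w + \sum_(i < n) tnth y i * c i] =
  tail [seq (a i, c i) | i <- enum 'I_n] w.
Proof.
elim: n a c Q w => [|n IH] a c Q w a0 QE.
  rewrite enum_ord0/=.
  have -> : [set y : 0.-tuple R | 0 <= w + \sum_(i < 0) tnth y i * c i] = [set _ | 0 <= w].
    by apply/seteqP; split => y /=; rewrite big_ord0 addr0.
  rewrite /step; case: (leP 0 w) => w0.
    by rewrite (_ : [set _ | _] = setT) ?probability_setT//; apply/seteqP; split.
  by rewrite (_ : [set _ | _] = set0) ?measure0//; apply/seteqP; split.
have P1 : gamma_prob (a ord0) setT = 1%E.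
  by rewrite -gamma_lawE//; exact: probability_setT.
have [Q' Q'E QQ'] := is_product_law_behead P1 QE.
pose E w' : set (n.-tuple R) := [set y | 0 <= w' + \sum_(i < n) tnth y i * c (lift ord0 i)].
have EE w' : Q' (E w') = tail [seq (a (lift ord0 i), c (lift ord0 i)) | i <- enum 'I_n] w'.
  by apply: (IH (fun i => a (lift ord0 i)) (fun i => c (lift ord0 i))).
(* [R] carries two measurable structures with the same measurable sets; [g] is
   the gamma law on the one used for tuples *)
have mid : measurable_fun setT (fun x : measurableTypeR R => x : R) by move=> _ A mA; rewrite setTI.
pose g' := image_measure (gamma_law (a ord0)) mid.
have g'T : g' setT = 1%E by exact: probability_setT.
pose g : probability R R := mnormalize g' (dirac (0 : R) : probability R R).
have gE A : g A = gamma_law (a ord0) A by exact: mnormalize1E.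
pose phi (z : R * n.-tuple R) : n.+1.-tuple R := [the n.+1.-tuple R of z.1 :: z.2].
have mphi : measurable_fun setT phi.
  by apply: measurable_cons; [exact: measurable_fst|exact: measurable_snd].
pose m := image_measure (g \x Q')%E mphi.
have boxE (A : 'I_n.+1 -> set R) :
    phi @^-1` box A = A ord0 `*` box (fun i => A (lift ord0 i)).
  apply/seteqP; split => [[x y] yA|[x y] [/= Ax yA] i].
    split=> [|i] /=; first by have := yA ord0.
    by have := yA (lift ord0 i); rewrite /phi /= tnthS.
  by rewrite /phi /=; case: (unliftP ord0 i) => [j ->|->//]; rewrite tnthS; exact: yA.
have mE A : (forall i, measurable (A i)) -> m (box A) = Q (box A).
  move=> mA; rewrite QQ'//.
  transitivity ((g \x Q')%E (A ord0 `*` box (fun i => A (lift ord0 i)))).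
    by rewrite -boxE.
  rewrite product_measure1E//; last exact: measurable_box.
  by congr (_ * _)%E; exact: (etrans (gE _) (gamma_lawE (a0 _) (mA _))).
have mT : m setT = 1%E.
  have := @mE (fun=> setT) (fun=> measurableT).
  have -> : box (fun=> setT : set R) = [set: n.+1.-tuple R] by apply/seteqP; split.
  by move=> ->; exact: probability_setT.
pose Q2 : probability (n.+1.-tuple R) R := mnormalize m Q.
have Q2E A : Q2 A = m A by exact: mnormalize1E.
have mE0 := measurable_halfspace c w.
rewrite (@eq_tuple_law _ _ _ _ Q Q2 _ _ mE0); last by move=> A mA; rewrite Q2E mE.
rewrite Q2E.
pose t (z : R) := tail [seq (a (lift ord0 i), c (lift ord0 i)) | i <- enum 'I_n]
  (w + z * c ord0).
transitivity (\int[gamma_law (a ord0)]_z t z)%E; last first.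
  by rewrite enum_ordSl /= -map_comp.
have mt : measurable_fun setT t.
  exact: measurable_tail_comp.
transitivity (\int[g]_z t z)%E; last first.
  transitivity (\int[g']_z t z)%E.
    by apply: eq_measure_integral => A mA _; exact: gE.
  by rewrite (ge0_integral_image _ mid)// => x; exact: tail_ge0.
apply: eq_integral => z _.
have phiE y : w + \sum_(i < n.+1) tnth (phi (z, y)) i * c i =
    w + z * c ord0 + \sum_(i < n) tnth y i * c (lift ord0 i).
  rewrite big_ord_recl addrA; congr (_ + _).
  by apply: eq_bigr => i _; rewrite /phi /= tnthS.
rewrite /t -EE /comp; congr (Q' _); apply/seteqP; split => y.
  by rewrite /xsection/= inE/= phiE.
by rewrite /xsection/= inE/= phiE.
Qed.

End gamma_product.

Section dirichlet.
Context {R : realType}.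

Lemma gamma_prob_ge0 (a : R) : 0 <= a -> gamma_prob a `[0, +oo[ = 1%E.
Proof.
move=> a0; have mP : measurable (`[0, +oo[%classic : set (measurableTypeR R)).
  exact: measurable_itv.
rewrite -(gamma_lawE a0 mP); apply/eqP; rewrite eq_le; apply/andP; split.
  exact: probability_le1.
have -> : gamma_law a `[0%R, +oo[%classic =
    (\int[gamma_law a]_x (\1_(`[0%R, +oo[%classic) x)%:E)%E.
  by rewrite (integral_indic _ measurableT mP) setIT.
rewrite -(integral_cst_probability (gamma_law a) 1).
apply: gamma_le_integral => //.
- by apply/measurable_EFinP; exact: measurable_indic.
- by move=> x x0; rewrite indicE mem_setE in_itv/= x0.
Qed.

(** The half-space is a cone, so normalizing by the sum of the coordinates is
    harmless on the nonnegative orthant, which carries all the mass; a tuple of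
    sum 0 in the orthant vanishes and lies in the half-space anyway. *)
Lemma dirichlet_halfspace n (a c : 'I_n -> R) (D : set (n.-tuple R) -> \bar R) :
  (forall i, 0 <= a i) -> is_dirichlet a D ->
  (D [set y | (0 <= 0 + \sum_(i < n) tnth y i * c i)%R] <=
   tail [seq (a i, c i) | i <- enum 'I_n] 0)%E.
Proof.
move=> a0 [Q QE DE].
rewrite DE; last exact: measurable_halfspace.
rewrite -(gamma_product_tail c 0 a0 QE).
pose P := box (fun _ : 'I_n => `[0, +oo[%classic : set R).
have mP : measurable P by apply: measurable_box.
have QP : Q (~` P) = 0%E.
  rewrite probability_setC// (QE (fun=> `[0, +oo[%classic))// big1 ?subee//.
  by move=> i _; exact: gamma_prob_ge0.
pose H := [set y : n.-tuple R | (0 <= 0 + \sum_(i < n) tnth y i * c i)%R].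
have mH : measurable H by exact: measurable_halfspace.
rewrite -/H -(measureU0 mH (measurableC mP) QP).
have HE y : H [tuple tnth y i / \sum_(j < n) tnth y j | i < n] <->
    (0 <= 0 + \sum_(i < n) tnth y i / (\sum_(j < n) tnth y j) * c i)%R.
  rewrite /H /=; suff -> : \sum_(i < n)
      tnth [tuple tnth y i0 / \sum_(j < n) tnth y j | i0 < n] i * c i =
      \sum_(i < n) tnth y i / (\sum_(j < n) tnth y j) * c i by [].
  by apply: eq_bigr => i _; rewrite tnth_mktuple.
apply: le_measure; rewrite ?inE.
- rewrite [X in measurable X](_ : _ = [set y : n.-tuple R |
      0 <= 0 + \sum_(i < n) tnth y i / (\sum_(j < n) tnth y j) * c i]).
    rewrite -[X in measurable X]setTI; apply: (measurable_fun_ler (f := cst 0)) => //.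
    apply: measurable_funD => //; apply: measurable_sum => i.
    apply: measurable_funM => //; apply: measurable_funM.
      exact: measurable_tnth.
    apply: (@measurableT_comp _ _ _ _ _ _ (@GRing.inv R)).
      exact: measurable_invr.
    by apply: measurable_sum => j; exact: measurable_tnth.
  by apply/seteqP; split => y; rewrite /= -HE.
- by apply: measurableU => //; exact: measurableC.
- move=> y /HE/=; rewrite add0r.
  have [yP|yP] := pselect (P y); last by right.
  move=> yc; left; rewrite /H/= add0r.
  have y0 i : 0 <= tnth y i by have := yP i; rewrite /= in_itv/= andbT.
  pose S := \sum_(j < n) tnth y j.
  have S0 : 0 <= S by apply: sumr_ge0.
  have [S1|S1] := eqVneq S 0.
    rewrite big1// => i _.
    have /eqP := S1; rewrite psumr_eq0// => /allP/(_ i).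
    by rewrite mem_index_enum => /(_ isT)/eqP ->; rewrite mul0r.
  have {}S0 : 0 < S by rewrite lt_neqAle eq_sym S1.
  move: yc; under eq_bigr do rewrite mulrAC.
  by rewrite -mulr_suml pmulr_lge0// invr_gt0.
Qed.

End dirichlet.

Section dirichlet_process.
Local Open Scope ereal_scope.
Context d (T : measurableType d) (R : realType).

Lemma measurable_ev (U : set T) : measurable U ->
  measurable_fun setT (fun X : pprobability T R => (X : probability T R) U).
Proof.
move=> mU.
have mid : measurable_fun setT (fun X : pprobability T R => X) by exact: measurable_id.
exact: (measurable_kernel (kprobability mid) U mU).
Qed.

Lemma measurable_expectation (f : T -> R) (B : R) : measurable_fun setT f ->
  (forall x, `|f x| <= B)%R ->
  measurable_fun setT (fun X : pprobability T R => 'E_(X : probability T R)[f]).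
Proof.
move=> mf fB.
have mfB : measurable_fun setT (fun x => (f x + B)%:E).
  by apply/measurable_EFinP; exact: measurable_funD.
have fB0 x : 0 <= (f x + B)%:E.
  rewrite lee_fin -lerBlDr sub0r lerNl; apply: le_trans (fB x).
  by rewrite -normrN ler_norm.
rewrite (_ : (fun X => _) = (fun X : pprobability T R =>
    \int[(X : probability T R)]_x (f x + B)%:E - B%:E)).
  apply: emeasurable_funB => //.
  exact: (measurable_fun_integral_kernel measurable_ev fB0 mfB).
apply/funext => X; rewrite unlock.
have i_f := integrable_bounded (X : probability T R) mf fB.
have iB : (X : probability T R).-integrable setT (EFin \o cst B).
  exact: finite_measure_integrable_cst.
have -> : \int[(X : probability T R)]_x (f x + B)%:E =
    \int[(X : probability T R)]_x ((EFin \o f) x + (EFin \o cst B) x) by [].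
rewrite (integralD measurableT i_f iB).
have -> : \int[(X : probability T R)]_x (EFin \o cst B) x = B%:E.
  exact: integral_cst_probability.
by rewrite addeK.
Qed.

Lemma integral_step_fun (P : probability T R) n (B : 'I_n -> set T)
    (c : 'I_n -> R) (s := fun x : T => (\sum_(i < n) c i * \1_(B i) x)%R) :
  (forall i, measurable (B i)) ->
  P.-integrable setT (EFin \o s) /\
  \int[P]_x (s x)%:E = (\sum_(i < n) c i * fine (P (B i)))%R%:E.
Proof.
move=> mB.
have iBi i : P.-integrable setT (EFin \o \1_(B i)).
  apply: (@integrable_bounded _ _ _ P (\1_(B i)) 1%R).
    by apply: measurable_indic; exact: mB.
  by move=> x; rewrite indicE ger0_norm ?ler0n// lern1 leq_b1.
have icB i : P.-integrable setT (EFin \o (fun x => c i * \1_(B i) x)%R).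
  exact: (integrableZl measurableT (c i) (iBi i)).
split.
  have := @integrable_sum _ _ _ P _ measurableT _ (index_enum 'I_n) xpredT _ (fun i _ => icB i).
  by apply: eq_integrable => // x _; rewrite /s /= sumEFin.
transitivity (\int[P]_x \sum_(i < n) (EFin \o (fun x => c i * \1_(B i) x)%R) x).
  by apply: eq_integral => x _; rewrite /s sumEFin.
rewrite (integral_sum measurableT icB) -sumEFin; apply: eq_bigr => i _.
apply: (etrans (integralZl measurableT (iBi i) (c i))).
by rewrite integral_indic// setIT EFinM fineK// fin_num_measure.
Qed.

(** Replacing [f] by its upper bound on each cell of a partition turns the
    event into a half-space of the simplex. *)
Lemma dirichlet_process_le_tail (alpha : R) (nu0 : probability T R)
    (DP : probability (pprobability T R) R) (f : T -> R) (u M : R)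
    n (B : 'I_n -> set T) (c : 'I_n -> R) :
  (0 <= alpha)%R -> is_dirichlet_process alpha nu0 DP ->
  measurable_fun setT f -> (forall x, `|f x| <= M)%R ->
  (forall i, measurable (B i)) -> trivIset setT B -> \bigcup_i B i = setT ->
  (forall i x, B i x -> f x - u <= c i)%R ->
  DP [set X : probability T R | u%:E <= 'E_X[f]] <=
  tail [seq (alpha * fine (nu0 (B i)), c i)%R | i <- enum 'I_n] 0.
Proof.
move=> alpha0 DPE mf fM mB tB UB fc.
have a0 i : (0 <= alpha * fine (nu0 (B i)))%R by rewrite mulr_ge0// fine_ge0.
apply: le_trans (dirichlet_halfspace c a0 (DPE n B mB tB UB)).
have tE (X : probability T R) :
    (\sum_(i < n) tnth [tuple fine (X (B i)) | i < n] i * c i =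
     \sum_(i < n) fine (X (B i)) * c i)%R.
  by apply: eq_bigr => i _; rewrite tnth_mktuple.
rewrite /pushforward; apply: le_measure; rewrite ?inE.
- rewrite -[X in measurable X]setTI.
  exact: (emeasurable_fun_c_infty measurableT (measurable_expectation mf fM)).
- rewrite [X in measurable X](_ : _ = [set X : pprobability T R |
      (0 <= 0 + \sum_(i < n) fine ((X : probability T R) (B i)) * c i)%R]).
    rewrite -[X in measurable X]setTI; apply: (measurable_fun_ler (f := cst 0%R)) => //.
    apply: measurable_funD => //; apply: measurable_sum => i.
    apply: measurable_funM => //.
    by apply: measurableT_comp => //; exact: measurable_ev.
  by apply/seteqP; split => X /=; rewrite tE.
- move=> X /=; rewrite unlock add0r tE => uX.
  pose s x : R := (\sum_(i < n) c i * \1_(B i) x)%R.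
  have fs x : (f x <= u + s x)%R.
    have [i _ Bix] : (\bigcup_i B i) x by rewrite UB.
    rewrite /s (bigD1 i)//= indicE mem_set// mulr1 big1 ?addr0; last first.
      move=> j ji; rewrite indicE memNset ?mulr0// => Bjx.
      by move/eqP: ji; apply; apply: (tB j i) => //; exists x.
    by rewrite -lerBlDl; exact: fc.
  have i_f := integrable_bounded X mf fM.
  have [i_s sE] := integral_step_fun X c mB.
  have iu : X.-integrable setT (EFin \o cst u).
    exact: finite_measure_integrable_cst.
  have : u%:E <= u%:E + \int[X]_x (s x)%:E.
    apply: (le_trans uX).
    have <- : \int[X]_x (EFin \o cst u) x = u%:E := integral_cst_probability X u.
    rewrite -(integralD measurableT iu i_s).
    apply: le_integral => //; first exact: integrableD.
    by move=> x _; rewrite -EFinD lee_fin.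
  rewrite sE -EFinD lee_fin lerDl.
  by under eq_bigr do rewrite mulrC.
Qed.

End dirichlet_process.

(** * The objective in dual form *)

Section objective_dual.
Local Open Scope ereal_scope.
Context d (T : measurableType d) (R : realType).
Variables (alpha : {posnum R}) (nu0 : probability T R) (f : T -> R).
Variables (u B Y : R) (x0 : T).
Hypotheses (mf : measurable_fun setT f) (yB : forall x, (`|f x - u| <= B)%R)
  (yY : forall x, (f x - u <= Y)%R) (Y0 : (0 < Y)%R) (yx0 : (f x0 - u = Y)%R).

Let anu0 : {finite_measure set T -> \bar R} := mscale alpha%:num%:nng%R nu0.

Let anu0T : anu0 setT = alpha%:num%:E.
Proof. by rewrite /anu0 /= /mscale /= [nu0 setT]probability_setT mule1. Qed.

Variable eta : {finite_measure set T -> \bar R}.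
Hypothesis feas : feasible alpha nu0 eta.

Let rho : {measure set T -> \bar R} := mdiff anu0 eta.

Lemma mdiff_setT : rho setT = alpha%:num%:E - eta setT.
Proof. by rewrite /rho /= mdiffE ?anu0T//; case: feas. Qed.

Let r := fine (alpha%:num%:E - eta setT).

Let rE : rho setT = r%:E.
Proof. by rewrite mdiff_setT /r fineK// fin_numB fin_num_measure. Qed.

Let r0 : (0 <= r)%R.
Proof. by rewrite -lee_fin -rE. Qed.

Let integral_normalize (g : T -> R) (M : R) : (0 < r)%R ->
  measurable_fun setT g -> (forall x, `|g x| <= M)%R ->
  \int[mnormalize rho nu0]_x (g x)%:E = r^-1%:E * \int[rho]_x (g x)%:E.
Proof.
move=> r_gt0 mg gM.
have rhoy : rho setT < +oo by rewrite rE ltry.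
apply: (etrans (@integral_dominated _ _ _ rho (mnormalize rho nu0)
  (fun=> (r^-1)%R) g (r^-1)%R M rhoy _ _ _ mg gM)) => //.
- by move=> x; rewrite lexx andbT invr_ge0.
- move=> A mA; rewrite (integral_cst rho mA).
  exact: mnormalizeE r_gt0 rE.
- under eq_integral do rewrite mulrC EFinM.
  exact: (integralZl measurableT (integrable_bounded_lty rhoy mg gM)).
Qed.

(** When [eta] takes the whole mass, the objective vanishes, and the bound at
    [l = 0] says that [0 <= M]. *)
Lemma objective_le_dual (M : \bar R) :
  (forall l : R, (0 <= l)%R -> (l * Y < 1)%R ->
    \int[rho]_x (ln (tilt f u l x))%:E <= M) ->
  objective alpha nu0 u f eta <= M.
Proof.
move=> HM; rewrite /objective -mdiff_setT rE.
have [rp|] := ltP 0%R r; last first.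
  move=> rle; have -> : r = 0%R by apply/eqP; rewrite eq_le rle r0.
  rewrite mul0e; apply: le_trans (HM 0%R (lexx _) _); last by rewrite mul0r.
  by apply: integral_ge0 => x _; rewrite /tilt mul0r subr0 ln1.
have -> : M = r%:E * (r^-1%:E * M).
  by rewrite muleA -EFinM divff ?mul1e// gt_eqF.
apply: lee_wpmul2l; first by rewrite lee_fin.
apply: (Kinf_le_dual mf yB yY Y0 yx0) => l l0 lY.
rewrite (integral_normalize rp (measurable_ln_tilt u l mf)
  (ln_tilt_bounded yB yY l0 lY)).
by apply: lee_wpmul2l; [rewrite lee_fin invr_ge0|exact: HM].
Qed.

Lemma dual_le_objective (l : R) : (0 <= l)%R -> (l * Y < 1)%R ->
  \int[rho]_x (ln (tilt f u l x))%:E <= objective alpha nu0 u f eta.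
Proof.
move=> l0 lY; rewrite /objective -mdiff_setT rE.
have mg := measurable_ln_tilt u l mf.
have [rp|] := ltP 0%R r; last first.
  move=> rle; have re : r = 0%R by apply/eqP; rewrite eq_le rle r0.
  rewrite re mul0e null_set_integral//; first exact/measurable_EFinP.
  by rewrite rE re.
have := dual_le_Kinf (mnormalize rho nu0) mf yB yY l0 lY.
rewrite (integral_normalize rp mg (ln_tilt_bounded yB yY l0 lY)).
move=> /(lee_wpmul2l (x := r%:E)); rewrite lee_fin => /(_ r0).
by rewrite muleA -EFinM divff ?mul1e// gt_eqF.
Qed.

End objective_dual.

Section mdiff_integral.
Local Open Scope ereal_scope.
Context d (T : measurableType d) (R : realType).
Variables (mu eta : {finite_measure set T -> \bar R}) (etamu : mle eta mu).

Lemma mdiff_lty : mdiff mu eta setT < +oo.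
Proof.
by rewrite mdiffE// ltey_eq fin_numB !fin_num_measure.
Qed.

Lemma integral_mdiff (g : T -> R) (M : R) :
  measurable_fun setT g -> (forall x, `|g x| <= M)%R ->
  \int[mu]_x (g x)%:E =
  \int[eta]_x (g x)%:E + \int[mdiff mu eta]_x (g x)%:E.
Proof.
move=> mg gM.
rewrite (eq_measure_integral (measure_add eta (mdiff mu eta))); last first.
  move=> A mA _; apply/esym; apply: (etrans (measure_addE _ _ _)).
  by rewrite /= mdiffE// addeC subeK// fin_num_measure.
apply: integral_measure_add => //.
- exact: integrable_bounded mg gM.
- exact: integrable_bounded_lty mdiff_lty mg gM.
Qed.

Lemma ge0_le_integral_measure (g : T -> R) (M : R) :
  measurable_fun setT g -> (forall x, 0 <= g x <= M)%R ->
  \int[eta]_x (g x)%:E <= \int[mu]_x (g x)%:E.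
Proof.
move=> mg gM; rewrite (integral_mdiff mg (M := M)) ?leeDl//.
- by apply: integral_ge0 => x _; rewrite lee_fin; case/andP: (gM x).
- by move=> x; case/andP: (gM x) => g0 gx; rewrite ger0_norm.
Qed.

End mdiff_integral.

(** * Cutting off the top of [f] *)

Section truncation.
Local Open Scope ereal_scope.
Context d (T : measurableType d) (R : realType).
Variables (alpha : {posnum R}) (nu0 : probability T R) (f : T -> R).
Variables (u v k B Y : R).
Hypotheses (mf : measurable_fun setT f) (yB : forall x, (`|f x - u| <= B)%R)
  (yY : forall x, (f x - u <= Y)%R).
Hypotheses (uv : (u <= v)%R) (k0 : (0 <= k)%R) (ka : (k <= alpha%:num)%R).

Let E1 : set T := f @^-1` `]v, +oo[.
Let E0 : set T := f @^-1` [set v].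
Let b : R := (alpha%:num * fine (nu0 E1))%R.
Let e : R := (k * fine (nu0 E0))%R.

(** Either the unit of mass is exhausted, or the cut goes down to the level [u],
    where the dual integrand vanishes. *)
Hypotheses (be1 : (b + e <= 1)%R) (tight : (v = u \/ b + e = 1)%R).

Let anu0 : {finite_measure set T -> \bar R} := mscale alpha%:num%:nng%R nu0.

Lemma measurable_upper_level : measurable E1.
Proof. by rewrite -[E1]setTI; apply: mf. Qed.
Let mE1 := measurable_upper_level.

Lemma measurable_level : measurable E0.
Proof. by rewrite -[E0]setTI; apply: mf. Qed.
Let mE0 := measurable_level.

Definition cut_density (x : T) : R :=
  (alpha%:num * \1_E1 x + k * \1_E0 x)%R.

Lemma cut_densityE x : cut_density x =
  (if v < f x then alpha%:num else if f x == v then k else 0)%R.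
Proof.
rewrite /cut_density !indicE.
have -> : (x \in E1) = (v < f x)%R.
  by apply/idP/idP; rewrite inE /E1/= in_itv/= andbT.
have -> : (x \in E0) = (f x == v)%R.
  by apply/idP/eqP; rewrite inE.
case: ltgtP => _ /=; rewrite ?mulr1 ?mulr0 ?addr0 ?add0r//.
Qed.

Lemma cut_density_bounds x : (0 <= cut_density x <= alpha%:num)%R.
Proof.
rewrite cut_densityE; case: ifP => _; first by rewrite lexx andbT.
by case: ifP => _; [rewrite k0 ka|rewrite lexx/=].
Qed.

Lemma measurable_cut_density : measurable_fun setT cut_density.
Proof.
by apply: measurable_funD; apply: measurable_funM => //; exact: measurable_indic.
Qed.

Let cut0 x : (0 <= cut_density x)%R.
Proof. by case/andP: (cut_density_bounds x). Qed.

Let cut_measure : {measure set T -> \bar R} :=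
  density nu0 measurable_cut_density cut0.

Lemma cut_measureE A : measurable A ->
  \int[nu0]_(x in A) (cut_density x)%:E =
  alpha%:num%:E * nu0 (A `&` E1) + k%:E * nu0 (A `&` E0).
Proof.
move=> mA; under eq_integral do rewrite EFinD !EFinM.
have m1 E : measurable E -> measurable_fun A (fun x => (\1_E x : R)%:E).
  move=> mE; apply/measurable_EFinP; apply: measurable_funTS.
  exact: measurable_indic.
rewrite ge0_integralD//.
- rewrite !ge0_integralZl ?integral_indic//; [|exact: m1..].
  by rewrite ![_ `&` A]setIC.
- by apply: emeasurable_funM => //; exact: m1.
- by move=> x _; rewrite mule_ge0// lee_fin.
- by apply: emeasurable_funM => //; exact: m1.
Qed.

Let fineK0 E : measurable E -> nu0 E = (fine (nu0 E))%:E.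
Proof. by move=> mE; rewrite fineK// fin_num_measure. Qed.

Let cutT : cut_measure setT = (b + e)%:E.
Proof.
apply: (etrans (cut_measureE measurableT)).
by rewrite !setTI (fineK0 mE1) (fineK0 mE0).
Qed.

Let cutTy : cut_measure setT < +oo.
Proof. by rewrite cutT ltry. Qed.

(** [mfrestr] only serves to provide the structure of finite measure. *)
Let cut : {finite_measure set T -> \bar R} := mfrestr measurableT cutTy.

Let cutE A : cut A = \int[nu0]_(x in A) (cut_density x)%:E.
Proof. by rewrite /cut /= /mfrestr /mrestr setIT. Qed.

Let cut_setT : cut setT = (b + e)%:E.
Proof. by rewrite cutE -cutT. Qed.

Let anu0E A : measurable A -> anu0 A = \int[nu0]_(x in A) (alpha%:num)%:E.
Proof. by move=> mA; rewrite integral_cst. Qed.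

Lemma feasible_cut : feasible alpha nu0 cut.
Proof.
split; first by rewrite cut_setT lee_fin.
move=> A mA; rewrite cutE (anu0E mA); apply: ge0_le_integral => //.
- by move=> x _; rewrite lee_fin.
- by apply/measurable_EFinP; exact: measurable_funTS measurable_cut_density.
- by move=> x _; rewrite lee_fin; case/andP: (cut_density_bounds x).
Qed.

Lemma integral_cut (F : T -> R) (M : R) :
  measurable_fun setT F -> (forall x, `|F x| <= M)%R ->
  \int[cut]_x (F x)%:E = \int[nu0]_x (F x * cut_density x)%:E.
Proof.
move=> mF FM; apply: (integral_dominated _ measurable_cut_density
  cut_density_bounds _ mF FM) => //.
- by rewrite -ge0_fin_numE// fin_num_measure.
- by move=> A _; exact: cutE.
Qed.

Section tilt_cut.
Variable l : R.
Hypotheses (l0 : (0 <= l)%R) (lY : (l * Y < 1)%R).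
Hypothesis vY : (v - u <= Y)%R.

Let g x := ln (tilt f u l x).
Let g0 : R := ln (1 - l * (v - u)).
Let M := (`|ln (1 - l * Y)| + `|ln (1 + l * B)|)%R.
Let mg : measurable_fun setT g := measurable_ln_tilt u l mf.
Let gM : forall x, (`|g x| <= M)%R := ln_tilt_bounded yB yY l0 lY.

Let lvY : (0 < 1 - l * (v - u))%R.
Proof. by rewrite subr_gt0; apply: le_lt_trans lY; rewrite ler_wpM2l. Qed.

Let g0_le0 : (g0 <= 0)%R.
Proof. by apply: ln_le0; rewrite gerBl mulr_ge0// subr_ge0. Qed.

Let g0_tight : (g0 = 0 \/ b + e = 1)%R.
Proof.
by case: tight => [vu|]; [left; rewrite /g0 vu subrr mulr0 subr0 ln1|right].
Qed.

Let g_above x : (v <= f x)%R -> (g x <= g0)%R.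
Proof.
move=> vf; rewrite ler_ln ?posrE//; last exact: (tilt_gt0 yY l0 lY).
by rewrite lerD2l lerN2 ler_wpM2l// lerD2r.
Qed.

Let g_below x : (f x <= v)%R -> (g0 <= g x)%R.
Proof.
move=> fv; rewrite ler_ln ?posrE//; last exact: (tilt_gt0 yY l0 lY).
by rewrite lerD2l lerN2 ler_wpM2l// lerD2r.
Qed.

(** How far the dual integrand falls below its value [g0] at the level [v]. *)
Let w x : R := (Num.max 0 (g0 - g x))%R.

Let mw : measurable_fun setT w.
Proof. by apply: measurable_maxr => //; exact: measurable_funB. Qed.

Let w_bounds x : (0 <= w x <= `|g0| + M)%R.
Proof.
rewrite le_max lexx/= ge_max addr_ge0//=; last exact: le_trans (gM x).
apply: le_trans (ler_norm _) _; apply: le_trans (ler_normB _ _) _.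
by rewrite lerD2l.
Qed.

Let wM x : (`|w x| <= `|g0| + M)%R.
Proof. by case/andP: (w_bounds x) => w0 wM; rewrite ger0_norm. Qed.

Let g0w x : (g0 - w x <= g x)%R.
Proof. by rewrite lerBlDr -lerBlDl le_max lexx orbT. Qed.

Let g_cut x : (g x * cut_density x = (g0 - w x) * cut_density x)%R.
Proof.
rewrite cut_densityE; case: ifPn => [vf|].
  by rewrite /w max_r ?subr_ge0 ?g_above// ?ltW// opprB addrC subrK.
case: ifPn => [/eqP vf _|]; last by rewrite !mulr0.
have gx : g x = g0 by rewrite /g /tilt vf.
by rewrite /w gx subrr maxxx subr0.
Qed.

Let fin_int (m : {finite_measure set T -> \bar R}) (F : T -> R) (C : R) :
  measurable_fun setT F -> (forall x, `|F x| <= C)%R ->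
  \int[m]_x (F x)%:E \is a fin_num.
Proof.
by move=> mF FC; apply: integrable_fin_num => //; exact: integrable_bounded mF FC.
Qed.

Let integral_g0w (m : {finite_measure set T -> \bar R}) :
  \int[m]_x (g0 - w x)%:E = g0%:E * m setT - \int[m]_x (w x)%:E.
Proof.
have ig0 : m.-integrable setT (EFin \o cst g0).
  exact: (@integrable_bounded _ _ _ m (cst g0) `|g0|%R).
have iw : m.-integrable setT (EFin \o w).
  exact: (@integrable_bounded _ _ _ m _ _ mw wM).
rewrite -(integral_cst m measurableT g0%:E) -(integralB measurableT ig0 iw).
by apply: eq_integral => x _; rewrite /= EFinB.
Qed.

Let integral_w_cut : \int[cut]_x (w x)%:E = \int[anu0]_x (w x)%:E.
Proof.
rewrite (integral_cut mw wM).
rewrite (@integral_dominated _ _ _ nu0 anu0 (fun=> alpha%:num) w alpha%:num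
  (`|g0| + M)%R _ _ _ anu0E mw wM)//.
- apply: eq_integral => x _; congr EFin; rewrite cut_densityE.
  case: ifPn => [//|]; rewrite -leNgt => fv.
  by rewrite /w max_l ?mul0r// subr_le0 g_below.
- by rewrite -ge0_fin_numE// fin_num_measure.
- by move=> x; rewrite lexx andbT.
Qed.

Let integral_g_cut :
  \int[cut]_x (g x)%:E = g0%:E * (b + e)%:E - \int[anu0]_x (w x)%:E.
Proof.
rewrite (integral_cut mg gM) -cut_setT -integral_w_cut -integral_g0w.
rewrite (@integral_cut (fun x => g0 - w x)%R (`|g0| + (`|g0| + M))%R).
- by apply: eq_integral => x _; rewrite g_cut.
- exact: measurable_funB.
- by move=> x; apply: le_trans (ler_normB _ _) _; rewrite lerD2l.
Qed.

(** Among all feasible measures, the cut removes the least of the dual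
    integrand: where [f > v], where the integrand is lowest, it removes all
    there is, and it takes what it can of the rest of the unit of mass at the
    level [f = v]. *)
Lemma integral_mdiff_cut (eta : {finite_measure set T -> \bar R}) :
  feasible alpha nu0 eta ->
  \int[mdiff anu0 eta]_x (g x)%:E <= \int[mdiff anu0 cut]_x (g x)%:E.
Proof.
move=> [etaT etale].
have h1 : \int[anu0]_x (g x)%:E = \int[eta]_x (g x)%:E +
    \int[mdiff anu0 eta]_x (g x)%:E := integral_mdiff etale mg gM.
have h2 : \int[anu0]_x (g x)%:E = \int[cut]_x (g x)%:E +
    \int[mdiff anu0 cut]_x (g x)%:E := integral_mdiff (proj2 feasible_cut) mg gM.
have h3 : g0%:E * eta setT - \int[anu0]_x (w x)%:E <= \int[eta]_x (g x)%:E.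
  apply: (@le_trans _ _ (\int[eta]_x (g0 - w x)%:E)).
    rewrite integral_g0w leeB// (ge0_le_integral_measure etale mw (M := (`|g0| + M)%R))//.
  apply: le_integral => //.
  - apply: (@integrable_bounded _ _ _ eta (fun x => g0 - w x)%R
      (`|g0| + (`|g0| + M))%R); first exact: measurable_funB.
    by move=> x; apply: le_trans (ler_normB _ _) _; rewrite lerD2l.
  - exact: integrable_bounded mg gM.
  - by move=> x _; rewrite lee_fin.
have h4 := integral_g_cut.
have f1 := fin_int anu0 mg gM.
have f2 := fin_int eta mg gM.
have f3 := fin_int cut mg gM.
have f4 := fin_int anu0 mw wM.
have f5 : eta setT \is a fin_num by rewrite fin_num_measure.
have f6 : \int[mdiff anu0 eta]_x (g x)%:E \is a fin_num.
  apply: integrable_fin_num => //.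
  exact: integrable_bounded_lty (mdiff_lty etale) mg gM.
have f7 : \int[mdiff anu0 cut]_x (g x)%:E \is a fin_num.
  apply: integrable_fin_num => //.
  exact: integrable_bounded_lty (mdiff_lty (proj2 feasible_cut)) mg gM.
move: h1 h2 h3 h4 etaT.
rewrite -(fineK f1) -(fineK f2) -(fineK f3) -(fineK f4) -(fineK f5).
rewrite -(fineK f6) -(fineK f7) -!EFinM -!EFinB -!EFinD !lee_fin.
move=> [->] [h2] h3 [h4] etaT.
(* [g0 <= 0], and [g0 = 0] unless the cut has the maximal mass 1 *)
suff : (g0 * (b + e) <= g0 * fine (eta setT))%R by lra.
by case: g0_tight => [->|->]; rewrite ?mul0r// ler_wnM2l.
Qed.

Let h x : R := (alpha%:num - cut_density x)%R.

Let h_bounds x : (0 <= h x <= alpha%:num)%R.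
Proof.
by case/andP: (cut_density_bounds x) => c0 ca; rewrite subr_ge0 ca gerBl.
Qed.

Let mh : measurable_fun setT h.
Proof. by apply: measurable_funB => //; exact: measurable_cut_density. Qed.

Let integral_g_mdiff :
  \int[mdiff anu0 cut]_x (g x)%:E = \int[nu0]_x (g x * h x)%:E.
Proof.
apply: (integral_dominated _ mh h_bounds _ mg gM).
  by rewrite -ge0_fin_numE// fin_num_measure.
move=> A mA; apply: (etrans (mdiffE (proj2 feasible_cut) mA)).
rewrite cutE anu0E// -integralB//.
- apply: (integrableS measurableT) => //.
  exact: (@integrable_bounded _ _ _ nu0 (cst alpha%:num) `|alpha%:num|%R).
- apply: (integrableS measurableT) => //.
  apply: (@integrable_bounded _ _ _ nu0 cut_density alpha%:num).
    exact: measurable_cut_density.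
  by move=> x; case/andP: (cut_density_bounds x) => c0 ca; rewrite ger0_norm.
Qed.

(** The space is cut into [m] slices of width [1 / n] of [f < v], followed by the
    level [f = v] (index [m]) and the set [f > v] (index [m.+1]). *)
Section grid.
Variable n : nat.
Hypothesis n0 : (0 < n)%N.

Let nR : (0 < n%:R :> R)%R. Proof. by rewrite ltr0n. Qed.

Let y x : R := ((f x - u + B) * n%:R)%R.
Let m : nat := (Num.truncn (2 * B * n%:R : R)%R).+1.

Let y_bounds x : (0 <= y x < m%:R)%R.
Proof.
have /andP[fB1 fB2] : (- B <= f x - u <= B)%R by rewrite -ler_norml.
apply/andP; split; first by rewrite mulr_ge0 ?ler0n// -lerBlDr sub0r.
apply: le_lt_trans (truncnS_gt _).
by rewrite ler_wpM2r ?ler0n//; move: fB2; rewrite -(lerD2r B); lra.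
Qed.

Let in_cell (i : nat) (x : T) : bool :=
  if (v < f x)%R then i == m.+1 else if f x == v then i == m
  else (i%:R <= y x)%R && (y x < i.+1%:R)%R.

Let cell (i : nat) : set T := [set x | in_cell i x].

Let measurable_cell i : measurable (cell i).
Proof.
have my : measurable_fun setT y.
  by apply: measurable_funM => //; apply: measurable_funD => //;
    exact: measurable_funB.
have mb : measurable_fun setT (in_cell i).
  apply: measurable_fun_ifT; first exact: measurable_fun_ltr.
    exact: measurable_cst.
  apply: measurable_fun_ifT; first exact: measurable_fun_eqr.
    exact: measurable_cst.
  apply: measurable_and; first exact: measurable_fun_ler.
  exact: measurable_fun_ltr.
have -> : cell i = setT `&` in_cell i @^-1` [set true].
  by apply/seteqP; split => x; [split|case].
exact: mb.
Qed.

Let trivIset_cell : trivIset setT (fun i : 'I_m.+2 => cell i).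
Proof.
move=> i j _ _ [x [/= ix jx]]; apply/val_inj => /=; move: ix jx.
rewrite /cell /= /in_cell; case: ifP => _; first by move=> /eqP -> /eqP.
case: ifP => _; first by move=> /eqP -> /eqP.
have /andP[y0 _] := y_bounds x.
by rewrite -!truncn_eq// => /eqP -> /eqP.
Qed.

Let cell_cover x : exists i : 'I_m.+2, cell i x.
Proof.
have mm : (m < m.+2)%N by rewrite ltnS.
have [y0 ym] := andP (y_bounds x).
have im : (Num.truncn (y x) < m.+2)%N.
  by apply: (@ltn_trans m) => //; rewrite truncn_lt_nat.
rewrite /cell /= /in_cell; case: (v < f x)%R; first by exists ord_max => /=.
case: (f x == v); first by exists (Ordinal mm) => /=.
by exists (Ordinal im) => /=; rewrite truncn_itv.
Qed.

Let cell_top : cell m.+1 = E1.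
Proof.
apply/seteqP; split => x; rewrite /cell /E1 /= /in_cell in_itv/= andbT.
  case: ifP => // _; case: ifP => _; first by rewrite gtn_eqF.
  by have /andP[_ ym] := y_bounds x; move=> /andP[/le_lt_trans/(_ ym)];
    rewrite ltr_nat ltnNge leqnSn.
by move=> ->.
Qed.

Let cell_level : cell m = E0.
Proof.
apply/seteqP; split => x; rewrite /cell /E0 /= /in_cell.
  case: ifP => _; first by rewrite ltn_eqF.
  case: ifP => [/eqP //|_].
  by have /andP[_ ym] := y_bounds x; move=> /andP[/le_lt_trans/(_ ym)];
    rewrite ltxx.
by move=> ->; rewrite ltxx eqxx.
Qed.

(** Capped at [Y], so that [l * c i < 1]. *)
Let c (i : nat) : R :=
  (if i == m.+1 then Y else if i == m then v - u
   else Num.min (i.+1%:R / n%:R - B) Y)%R.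

Let c_leY i : (c i <= Y)%R.
Proof.
by rewrite /c; case: ifP => // _; case: ifP => // _; rewrite ge_min lexx orbT.
Qed.

Let cell_le i x : cell i x -> (f x - u <= c i)%R.
Proof.
rewrite /cell /= /in_cell /c; case: ifP => [_ /eqP ->|_].
  by rewrite eqxx.
case: ifP => [/eqP -> /eqP ->|_]; first by rewrite ltn_eqF// eqxx.
move=> /andP[iy yi]; case: ifP => // _; case: ifP => [/eqP im|_].
  by have /andP[_] := y_bounds x; rewrite -im => /(le_lt_trans iy); rewrite ltxx.
by rewrite le_min yY andbT lerBrDr ler_pdivlMr// ltW.
Qed.

Let wt (i : nat) : R := (alpha%:num * fine (nu0 (cell i)))%R.

Let wt_ge0 i : (0 <= wt i)%R.
Proof. by rewrite mulr_ge0// fine_ge0. Qed.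

Let eps : R := (l / n%:R / (1 - l * Y))%R.

Let lY0 : (0 < 1 - l * Y)%R. Proof. by rewrite subr_gt0. Qed.

Let lc0 i : (0 < 1 - l * c i)%R.
Proof. by rewrite subr_gt0; apply: le_lt_trans lY; rewrite ler_wpM2l. Qed.

Let eps_ge0 : (0 <= eps)%R.
Proof. by rewrite /eps !divr_ge0// ltW. Qed.

(** The mesh [1 / n] costs at most [eps] in the logarithm. *)
Let g_cell i x : (i < m)%N -> cell i x -> (f x < v)%R ->
  (g x <= ln (1 - l * c i) + eps)%R.
Proof.
move=> im + fv; rewrite /cell /= /in_cell ltNge (ltW fv)/= lt_eqF//.
move=> /andP[iy _].
have cy : (c i - n%:R^-1 <= f x - u)%R.
  rewrite /c ltn_eqF ?(ltn_trans im)// ltn_eqF// lerBlDr ge_min; apply/orP; left.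
  move: iy; rewrite -ler_pdivrMr// -natr1 mulrDl div1r => iy.
  by move: iy; rewrite -(lerD2r (n%:R^-1 - B)%R); lra.
have tg := tilt_gt0 yY l0 lY x.
have : (tilt f u l x <= (1 - l * c i) * (1 + eps))%R.
  apply: (@le_trans _ _ (1 - l * c i + l / n%:R)%R).
    rewrite /tilt; have := ler_wpM2l l0 cy; rewrite mulrBr; lra.
  rewrite mulrDr mulr1 lerD2l /eps mulrCA ler_peMr ?divr_ge0//.
  rewrite ler_pdivlMr// mul1r lerD2l lerN2 ler_wpM2l//.
rewrite -ler_ln ?posrE//; last by rewrite mulr_gt0// ltr_pwDl.
rewrite lnM ?posrE//; last by rewrite ltr_pwDl.
move=> /le_trans; apply; rewrite lerD2l.
by apply: le_ln1Dx; apply: lt_le_trans eps_ge0; rewrite ltrN10.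
Qed.

Let S : R := (\sum_(i < m) wt i * ln (1 - l * c i) + (wt m - (1 - b)) * g0)%R.

(** The integrand is bounded by a step function on the cells: on [f > v] the
    density of [alpha nu0 - cut] vanishes, on the level [f = v] it is
    [alpha - k], which leaves the mass [wt m - (1 - b)] if [g0 <> 0]. *)
Let dual_le_grid :
  \int[mdiff anu0 cut]_x (g x)%:E <= (S + alpha%:num * eps)%:E.
Proof.
pose dd (i : nat) : R := (if i == m.+1 then 0 else if i == m
  then (alpha%:num - k) * g0 else alpha%:num * ln (1 - l * c i))%R.
pose s x : R := (\sum_(i < m.+2) dd i * \1_(cell i) x)%R.
have [is_ sE] := @integral_step_fun _ _ _ nu0 _ (fun i : 'I_m.+2 => cell i)
  (fun i : 'I_m.+2 => dd i) (fun i => measurable_cell i).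
have ghs x : (g x * h x <= s x + alpha%:num * eps)%R.
  have [i ix] := cell_cover x.
  have -> : s x = dd i.
    rewrite /s (bigD1 i)//= big1 ?addr0.
      by rewrite indicE mem_set// mulr1.
    move=> j ji; rewrite indicE memNset ?mulr0// => jx.
    by move: ji; rewrite (trivIset_cell I I (ex_intro _ x (conj jx ix))) eqxx.
  have ae0 : (0 <= alpha%:num * eps)%R by rewrite mulr_ge0.
  rewrite /h cut_densityE /dd; move: ix; rewrite /cell /= /in_cell.
  case: ifPn => [_ ->|]; first by rewrite subrr mulr0 add0r.
  rewrite -leNgt => fv; case: ifPn => [/eqP fxv /eqP im|fxv].
    rewrite im ltn_eqF// eqxx; rewrite /g /tilt fxv -/g0 mulrC lerDl//.
  have {}fv : (f x < v)%R by rewrite lt_neqAle fxv fv.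
  move=> ix; have im : (i < m)%N.
    have := y_bounds x; case/andP: ix => iy _ /andP[_ /(le_lt_trans iy)].
    by rewrite ltr_nat.
  rewrite ltn_eqF ?(ltn_trans im)// ltn_eqF// subr0 mulrC -mulrDr ler_wpM2l//.
  apply: g_cell => //; rewrite /cell /= /in_cell.
  by rewrite ltNge (ltW fv)/= (negbTE fxv).
rewrite integral_g_mdiff.
have aeE : \int[nu0]_x (alpha%:num * eps)%:E = (alpha%:num * eps)%:E.
  exact: integral_cst_probability.
have iae : nu0.-integrable setT (EFin \o cst (alpha%:num * eps)%R).
  exact: (@integrable_bounded _ _ _ nu0 _ `|alpha%:num * eps|%R).
apply: (@le_trans _ _ (\int[nu0]_x (s x + alpha%:num * eps)%:E)).
  apply: le_integral => //.
  - apply: (@integrable_bounded _ _ _ nu0 (fun x => g x * h x)%R (M * alpha%:num)%R).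
      exact: measurable_funM.
    move=> x; rewrite normrM ler_pM//.
    by case/andP: (h_bounds x) => h0 ha; rewrite ger0_norm.
  - exact: (integrableD measurableT is_ iae).
  - by move=> x _; rewrite lee_fin.
rewrite (eq_integral (fun x => (EFin \o s) x +
  (EFin \o cst (alpha%:num * eps)%R) x))//.
rewrite (integralD measurableT is_ iae) sE aeE -EFinD lee_fin lerD2r.
have ddt : dd m.+1 = 0%R by rewrite /dd eqxx.
have ddm : dd m = ((alpha%:num - k) * g0)%R by rewrite /dd ltn_eqF// eqxx.
rewrite 2!big_ord_recr/= /S ddt mul0r addr0 ddm.
rewrite lerD//.
  apply: ler_sum => i _; rewrite /dd ltn_eqF ?(ltn_trans (ltn_ord i))//.
  by rewrite ltn_eqF//= /wt mulrAC.
rewrite cell_level /wt cell_level mulrAC.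
have -> : (alpha%:num * fine (nu0 E0) - (1 - b) =
  (alpha%:num - k) * fine (nu0 E0) - (1 - (b + e)))%R by rewrite /e; ring.
by case: g0_tight => [->|->]; rewrite ?mulr0// subrr subr0.
Qed.

Lemma dirichlet_process_le_grid (DP : probability (pprobability T R) R) :
  is_dirichlet_process alpha%:num nu0 DP -> (0 < Y)%R ->
  lne (DP [set X : probability T R | u%:E <= 'E_X[f]]) <=
  (alpha%:num * eps)%:E - \int[mdiff anu0 cut]_x (g x)%:E.
Proof.
move=> DPE Y0.
have alpha0 : (0 <= alpha%:num)%R by [].
have fM x : (`|f x| <= B + `|u|)%R.
  have -> : f x = (f x - u + u)%R by rewrite subrK.
  by apply: le_trans (ler_normD _ _) _; rewrite lerD2r.
have := @dirichlet_process_le_tail _ _ _ alpha%:num nu0 DP f u _ m.+2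
  (fun i : 'I_m.+2 => cell i) (fun i : 'I_m.+2 => c i) alpha0 DPE mf fM
  (fun i => measurable_cell i) trivIset_cell _ (fun i x => @cell_le i x).
have U : \bigcup_(i : 'I_m.+2) cell i = setT.
  by apply/seteqP; split => // x _; have [i ix] := cell_cover x; exists i.
move=> /(_ U).
have -> : [seq (alpha%:num * fine (nu0 (cell i)), c i)%R | i : 'I_m.+2 <- enum 'I_m.+2] =
    [seq (wt i, c i) | i <- iota 0 m] ++ [:: (wt m, v - u); (b, Y)]%R.
  have -> : [seq (alpha%:num * fine (nu0 (cell i)), c i)%R | i : 'I_m.+2 <- enum 'I_m.+2] =
      [seq (wt i, c i) | i <- iota 0 m.+2].
    by rewrite -val_enum_ord -map_comp; apply: eq_map.
  rewrite -[m.+2](addn2 m) iotaD map_cat; congr (_ ++ _) => /=.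
  by rewrite /c ltn_eqF// !eqxx /wt cell_top.
set E := [set X : probability T R | u%:E <= 'E_X[f]] => DPtail.
have DPS : DP E <= (expR (- S))%:E.
  apply: le_trans DPtail _; apply: le_trans (tail_cells _ l0 lY Y0 _ _ _ _ _) _.
  - by rewrite /b mulr_ge0 ?fine_ge0//=; apply: le_trans be1; rewrite lerDl mulr_ge0 ?fine_ge0.
  - exact: wt_ge0.
  - by rewrite subr_ge0 uv.
  - case: tight => [->|be]; [by left; rewrite subrr|right].
    by rewrite -be addrC addKr /e /wt cell_level ler_wpM2r ?fine_ge0.
  - by move=> _ /mapP[i _ ->]/=; split; [exact: wt_ge0|exact: c_leY].
  rewrite lee_fin mulr0 expR0 mul1r big_map -/(index_iota 0 m) big_mkord /S.
  rewrite [X in expR X]opprD expRD -sumrN expR_sum.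
  have pE (q z : R) : (0 < z)%R -> (z `^ (- q) = expR (- (q * ln z)))%R.
    by move=> z0; rewrite /powR gt_eqF// mulNr.
  rewrite pE// le_eqVlt; apply/orP; left; apply/eqP; congr (_ * _)%R.
  by apply: eq_bigr => i _; exact: (pE _ _ (lc0 i)).
have J : \int[mdiff anu0 cut]_x (g x)%:E \is a fin_num.
  apply: integrable_fin_num => //.
  exact: integrable_bounded_lty (mdiff_lty (proj2 feasible_cut)) mg gM.
have := dual_le_grid; rewrite -(fineK J) lee_fin => JS.
apply: (@le_trans _ _ (- S)%:E); last by rewrite -EFinB lee_fin; lra.
have DP0 : 0 <= DP E by exact: measure_ge0.
rewrite -[X in _ <= X%:E]expRK -lne_EFin ?expR_gt0// lee_lne//.
- by rewrite in_itv/= DP0 leey.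
- by rewrite in_itv/= leey andbT lee_fin expR_ge0.
Qed.

End grid.

(** The mesh tends to 0. *)
Lemma dirichlet_process_le_dual (DP : probability (pprobability T R) R) :
  is_dirichlet_process alpha%:num nu0 DP -> (0 < Y)%R ->
  lne (DP [set X : probability T R | u%:E <= 'E_X[f]]) <=
  - \int[mdiff anu0 cut]_x (g x)%:E.
Proof.
move=> DPE Y0; apply/lee_addgt0Pr => t t0.
pose n := (Num.truncn (alpha%:num * l / (1 - l * Y) / t)%R).+1.
apply: le_trans (@dirichlet_process_le_grid n _ DP DPE Y0) _ => //.
rewrite addeC leeD2l// lee_fin.
have lY0 : (0 < 1 - l * Y)%R by rewrite subr_gt0.
have nt := truncnS_gt (alpha%:num * l / (1 - l * Y) / t)%R.
have n0 : (0 < n%:R :> R)%R by rewrite ltr0n.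
have -> : (alpha%:num * (l / n%:R / (1 - l * Y)) =
  alpha%:num * l / (1 - l * Y) / n%:R)%R.
  by rewrite !mulrA; ring.
rewrite ler_pdivrMr// [leRHS]mulrC -ler_pdivrMr//.
exact: ltW nt.
Qed.

End tilt_cut.

Variable x0 : T.
Hypotheses (Y0 : (0 < Y)%R) (yx0 : (f x0 - u = Y)%R) (vY : (v - u <= Y)%R).

(** Both bounds hold for every [l], so they pass to the objective by duality. *)
Lemma cut_optimal : exists eta : {finite_measure set T -> \bar R},
  [/\ feasible alpha nu0 eta,
      forall eta' : {finite_measure set T -> \bar R},
        feasible alpha nu0 eta' ->
        objective alpha nu0 u f eta' <= objective alpha nu0 u f eta,
      forall DP : probability (pprobability T R) R,
        is_dirichlet_process alpha%:num nu0 DP ->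
        lne (DP [set X : probability T R | u%:E <= 'E_X[f]]) <=
        - objective alpha nu0 u f eta
    & forall A, measurable A -> eta A =
        alpha%:num%:E * nu0 (A `&` (f @^-1` `]v, +oo[)) +
        k%:E * nu0 (A `&` (f @^-1` [set v]))].
Proof.
exists cut; split; first exact: feasible_cut.
- move=> eta feas; apply: (objective_le_dual mf yB yY Y0 yx0 feas) => l l0 lY.
  apply: le_trans (integral_mdiff_cut l0 lY vY feas) _.
  exact: (dual_le_objective mf yB yY feasible_cut l0 lY).
- move=> DP DPE; rewrite leeNr.
  apply: (objective_le_dual mf yB yY Y0 yx0 feasible_cut) => l l0 lY.
  by rewrite leeNr; exact: (dirichlet_process_le_dual l0 lY vY DPE Y0).
- by move=> A mA; rewrite cutE cut_measureE.
Qed.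

End truncation.

(** * The threshold level *)

Section threshold.
Local Open Scope ereal_scope.
Context d (T : measurableType d) (R : realType).
Variables (alpha : {posnum R}) (nu0 : probability T R) (f : T -> R).
Variables (u fmax : R).
Hypotheses (mf : measurable_fun setT f) (f_le : forall x, (f x <= fmax)%R)
  (u_le : (u <= fmax)%R).

Let v := u1 alpha nu0 f u.
Let p (t : R) : \bar R := alpha%:num%:E * nu0 (f @^-1` `]t, +oo[).
Let S : set R := [set x | (u <= x)%R /\ p x <= 1].

Let m_above t : measurable (f @^-1` `]t, +oo[).
Proof. by rewrite -[_ @^-1` _]setTI; apply: mf. Qed.

Let p_nincr s t : (s <= t)%R -> p t <= p s.
Proof.
move=> st; apply: lee_wpmul2l => //; apply: le_measure; rewrite ?inE//.
by move=> x /=; rewrite !in_itv/= !andbT; exact: le_lt_trans.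
Qed.

Let S_fmax : S fmax.
Proof.
split=> //; rewrite /p (_ : _ @^-1` _ = set0) ?measure0 ?mule0//.
by apply/seteqP; split => x //=; rewrite in_itv/= andbT ltNge f_le.
Qed.

Let S_lb : lbound S u.
Proof. by move=> x []. Qed.

Let S_inf : has_inf S.
Proof. by split; [exists fmax|exists u]. Qed.

Lemma u1_bounds : (u <= v <= fmax)%R.
Proof.
apply/andP; split; first by apply: lb_le_inf => //; exists fmax.
by apply: ge_inf => //; exists u.
Qed.

(** Continuity from below along the levels [v + 1 / n], which are admissible
    by monotonicity. *)
Lemma measure_above_u1 : p v <= 1.
Proof.
pose F (n : nat) : set T := f @^-1` `](v + n.+1%:R^-1)%R, +oo[.
have FE : f @^-1` `]v, +oo[ = \bigcup_n F n.
  apply/seteqP; split => x /=.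
    rewrite in_itv/= andbT -subr_gt0 => vf.
    exists (Num.truncn (f x - v)^-1) => //; rewrite /F /= in_itv/= andbT.
    rewrite -ltrBrDl -[ltRHS]invrK ltf_pV2 ?posrE ?invr_gt0 ?ltr0n//.
    exact: truncnS_gt.
  move=> [n _]; rewrite /F /= !in_itv/= !andbT; apply: le_lt_trans.
  by rewrite lerDl invr_ge0.
have Fcvg : (nu0 \o F) n @[n --> \oo] --> nu0 (f @^-1` `]v, +oo[).
  rewrite FE; apply: nondecreasing_cvg_mu => //.
    by move=> n; exact: m_above.
    by rewrite -FE.
  apply/nondecreasing_seqP => n; apply/subsetPset => x.
  rewrite /F /= !in_itv/= !andbT; apply: le_lt_trans.
  by rewrite lerD2l lef_pV2 ?posrE ?ltr0n// ler_nat.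
have pcvg : p (v + n.+1%:R^-1)%R @[n --> \oo] --> p v.
  exact: cvgeZl Fcvg.
rewrite -(cvg_lim _ pcvg)//; apply: lime_le; first by apply/cvg_ex; exists (p v).
near=> n.
have [|s [us ps] sv] := @inf_adherent _ S (n.+1%:R^-1)%R _ S_inf.
  by rewrite invr_gt0.
by apply: le_trans ps; apply: p_nincr; exact: ltW.
Unshelve. all: by end_near.
Qed.

(** Continuity from above along levels in [[u, v[], none of which is admissible. *)
Lemma measure_from_u1 : (u < v)%R ->
  1 <= alpha%:num%:E * nu0 (f @^-1` `[v, +oo[).
Proof.
move=> uv; have vu0 : (0 < v - u)%R by rewrite subr_gt0.
pose t (n : nat) : R := (v - (v - u) / n.+1%:R)%R.
have tv n : (t n < v)%R by rewrite /t gtrBl divr_gt0.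
have ut n : (u <= t n)%R.
  rewrite /t lerBrDr -lerBrDl ler_pdivrMr ?ltr0n// ler_peMr ?ler1n// ltW//.
pose F (n : nat) : set T := f @^-1` `]t n, +oo[.
have FE : f @^-1` `[v, +oo[ = \bigcap_n F n.
  apply/seteqP; split => x /=.
    rewrite in_itv/= andbT => vf n _; rewrite /F /= in_itv/= andbT.
    exact: lt_le_trans vf.
  move=> Fx; rewrite in_itv/= andbT leNgt; apply/negP => fv.
  have vf : (0 < v - f x)%R by rewrite subr_gt0.
  have := Fx (Num.truncn ((v - u) / (v - f x))%R) I.
  rewrite /F /t /= in_itv/= andbT ltrBlDr -ltrBlDl; apply/negP.
  rewrite -leNgt ler_pdivrMr ?ltr0n// mulrC -ler_pdivrMr//.
  exact/ltW/truncnS_gt.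
have Fcvg : (nu0 \o F) n @[n --> \oo] --> nu0 (f @^-1` `[v, +oo[).
  rewrite FE; apply: nonincreasing_cvg_mu => //.
  - by rewrite -ge0_fin_numE// fin_num_measure//; exact: m_above.
  - by move=> n; exact: m_above.
  - by rewrite -FE -[_ @^-1` _]setTI; apply: mf.
  apply/nonincreasing_seqP => n; apply/subsetPset => x.
  rewrite /F /= !in_itv/= !andbT; apply: le_lt_trans.
  by rewrite /t lerD2l lerN2 ler_pM2l// lef_pV2 ?posrE ?ltr0n// ler_nat.
have pcvg : p (t n) @[n --> \oo] --> alpha%:num%:E * nu0 (f @^-1` `[v, +oo[).
  exact: cvgeZl Fcvg.
rewrite -(cvg_lim _ pcvg)//; apply: lime_ge; first by apply/cvg_ex; eexists; exact: pcvg.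
near=> n; rewrite leNgt; apply/negP => /ltW ptn.
have : S (t n) by split.
by move=> /(ge_inf (proj2 S_inf)); rewrite leNgt tv.
Unshelve. all: by end_near.
Qed.

End threshold.

Lemma continuous_measurable_borel (R : realType) (T : ptopologicalType)
    (f : T -> R) : continuous f -> measurable_fun setT (f : borel T -> R).
Proof.
move=> cf; apply: (measurability _ (RGenOInfty.measurableE R)) => _ [_ [r ->] <-].
rewrite setTI; apply: sub_sigma_algebra.
by apply: open_comp => // x _; exact: cf.
Qed.

(** * The deviation bound and its maximizer *)

Unset Implicit Arguments.
Set Strict Implicit.
Set Printing Implicit Defensive.

Theorem theorem2p3 (R : realType) (Omega : pmetricType R) (alpha : {posnum R})
    (nu0 : probability (borel Omega) R)
    (DP : probability (pprobability (borel Omega) R) R)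
    (f : Omega -> R) (fmin fmax u : R) :
  compact [set: Omega] ->
  msupport nu0 = [set: Omega] ->
  is_dirichlet_process alpha%:num nu0 DP ->
  continuous f ->
  range f fmin -> lbound (range f) fmin ->
  range f fmax -> ubound (range f) fmax ->
  fmin <= u < fmax ->
  exists eta : {finite_measure set (borel Omega) -> \bar R},
    [/\ feasible alpha nu0 eta,
        forall eta' : {finite_measure set (borel Omega) -> \bar R},
          feasible alpha nu0 eta' ->
          (objective alpha nu0 u f eta' <= objective alpha nu0 u f eta)%E,
        (lne (DP [set X : probability (borel Omega) R | u%:E <= 'E_X[f]])
          <= - objective alpha nu0 u f eta)%E,
        (1 <= alpha%:num%:E * nu0 (A1 alpha nu0 f u `|` A0 alpha nu0 f u))%E ->
          forall A : set (borel Omega), measurable A ->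
            eta A = eta_star alpha nu0 f u A
      & (alpha%:num%:E * nu0 (A1 alpha nu0 f u `|` A0 alpha nu0 f u) < 1)%E ->
          forall A : set (borel Omega), measurable A ->
            eta A = (alpha%:num%:E *
              nu0 (A `&` (A1 alpha nu0 f u `|` A0 alpha nu0 f u)))%E].
Proof.
move=> _ _ DPE cf [xmin _ fxmin] fmin_lb [x0 _ fx0] fmax_ub /andP[umin umax].
have mf := continuous_measurable_borel cf.
have f_le x : f x <= fmax by apply: fmax_ub; exists x.
have f_ge x : fmin <= f x by apply: fmin_lb; exists x.
set v := u1 alpha nu0 f u.
have /andP[uv vmax] := u1_bounds alpha nu0 f_le (ltW umax).
pose B1 : set (borel Omega) := A1 alpha nu0 f u.
pose B0 : set (borel Omega) := A0 alpha nu0 f u.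
have mB1 : measurable B1 by exact: measurable_upper_level.
have mB0 : measurable B0 by exact: measurable_level.
have nE E : measurable E -> nu0 E = (fine (nu0 E))%:E.
  by move=> mE; rewrite fineK// fin_num_measure.
have B10 : B1 `&` B0 = set0.
  apply/seteqP; split => x //=; rewrite /B1 /B0 /A1 /A0 /= in_itv/= andbT.
  by move=> [+ xv]; rewrite xv ltxx.
have nU A : measurable A ->
    (nu0 (A `&` (B1 `|` B0)) = nu0 (A `&` B1) + nu0 (A `&` B0))%E.
  move=> mA; rewrite setIUr measureU//; [exact: measurableI..|].
  by rewrite setIACA B10 setI0.
pose b := alpha%:num * fine (nu0 B1).
have bE : (alpha%:num%:E * nu0 B1 = b%:E)%E by rewrite (nE _ mB1).
have b1 : b <= 1.
  by have := measure_above_u1 alpha nu0 mf f_le (ltW umax); rewrite [X in (X <= _)%E]bE lee_fin.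
have yB x : `|f x - u| <= fmax - fmin.
  have := f_le x; have := f_ge x; rewrite ler_norml; lra.
have yY x : f x - u <= fmax - u by rewrite lerD2r.
have Y0 : 0 < fmax - u by rewrite subr_gt0.
have yx0 : f x0 - u = fmax - u by rewrite fx0.
have vY : v - u <= fmax - u by rewrite lerD2r.
pose a := alpha%:num * fine (nu0 B0).
have abE : (alpha%:num%:E * nu0 (B1 `|` B0) = (b + a)%:E)%E.
  by rewrite -[B1 `|` B0]setTI nU// !setTI (nE _ mB1) (nE _ mB0) -EFinD -EFinM mulrDr.
have B0_ge0 : 0 <= fine (nu0 B0) by exact: fine_ge0.
have [ba1|ba1] := leP 1 (b + a).
  (* the mass that remains after [A1], spread over [A0]; if [A0] is null then
     [b = 1] and [x / 0 = 0] is the right coefficient *)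
  pose k := (1 - b) / fine (nu0 B0).
  have kB0 : k * fine (nu0 B0) = 1 - b.
    have [B00|B00] := eqVneq (fine (nu0 B0)) 0; last by rewrite /k divfK.
    by move: ba1; rewrite /a B00 !mulr0 addr0 => b1'; lra.
  have k0 : 0 <= k by rewrite /k divr_ge0// subr_ge0.
  have ka : k <= alpha%:num.
    have [B00|B00] := eqVneq (fine (nu0 B0)) 0.
      by rewrite /k B00 invr0 mulr0.
    by rewrite /k ler_pdivrMr ?lt_neqAle 1?eq_sym ?B00// lerBlDl.
  have bk : b + k * fine (nu0 B0) <= 1 by rewrite kB0 subrKC.
  have tight : v = u \/ b + k * fine (nu0 B0) = 1 by right; rewrite kB0 subrKC.
  have [eta [feas opt bound etaE]] :=
    cut_optimal mf yB yY uv k0 ka bk tight Y0 yx0 vY.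
  exists eta; split => //.
  - exact: bound.
  - move=> _ A mA; rewrite etaE// /eta_star -/B1 -/B0 bE eqe.
    by case: eqP => [b1E|//]; rewrite /k b1E subrr mul0r mul0e adde0.
  - by rewrite -/B1 -/B0 abE lte_fin ltNge ba1.
(* otherwise the mass at and above the threshold would be at least 1 *)
have uv' : v = u.
  apply/eqP; rewrite eq_le uv andbT leNgt; apply/negP => u_lt.
  have := measure_from_u1 mf f_le (ltW umax) u_lt.
  have -> : f @^-1` `[u1 alpha nu0 f u, +oo[ = B1 `|` B0.
    apply/seteqP; split => x; rewrite /B1 /B0 /A1 /A0 /= !in_itv/= !andbT.
      by rewrite le_eqVlt => /orP[/eqP <-|->]; [right|left].
    by case=> [/ltW|->].
  by rewrite abE lee_fin leNgt ba1.
have a0 : 0 <= alpha%:num by [].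
have [eta [feas opt bound etaE]] :=
  cut_optimal mf yB yY uv a0 (lexx _) (ltW ba1) (or_introl uv') Y0 yx0 vY.
exists eta; split => //.
- exact: bound.
- by rewrite -/B1 -/B0 abE lee_fin leNgt ba1.
- move=> _ A mA; rewrite etaE// -/B1 -/B0 nU// ge0_muleDr//.
Qed.
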